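(* $$\sum_{n\geq 0}\frac{1}{(2n+1)^2}\left[\frac{1}{4^n}\binom{2n}{n}\right]^2 = {}_4F_3\left(\tfrac{1}{2},\tfrac{1}{2},\tfrac{1}{2},\tfrac{1}{2};1,\tfrac{3}{2},\tfrac{3}{2};1\right)= \frac{3\pi^2}{8}+\frac{\log^2(2)}{2}-\frac{16}{\pi}\,\operatorname{Im}\,\mathrm{Li}_3\left(\tfrac{1+i}{2}\right).$$
   Context: ${}_4F_3(a_1,\dots,a_4;b_1,b_2,b_3;z)=\sum_{n\ge 0}\frac{(a_1)_n(a_2)_n(a_3)_n(a_4)_n}{(b_1)_n(b_2)_n(b_3)_n}\frac{z^n}{n!}$ is the generalized hypergeometric series, where $(a)_n$ is the rising Pochhammer symbol. $\mathrm{Li}_3(z)=\sum_{m\geq 1}\frac{z^m}{m^3}$ for complex $|z|\leq 1$, and $\operatorname{Im}$ denotes the imaginary part. *)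

(* Defs.v *)
From Stdlib Require Import Reals Lra Lia.
From Coquelicot Require Import Coquelicot.
Open Scope R_scope.

(* Total sum of a complex series, computed componentwise.  It is meaningful
   for convergent series only; see [CSeries_unique], [CSeries_correct]. *)
Definition CSeries (u : nat -> C) : C :=
  (Series (fun n => Re (u n)), Series (fun n => Im (u n))).

Fixpoint Cpoch (a : C) (n : nat) : C :=
  match n with
  | O => RtoC 1
  | S k => (Cpoch a k * (a + INR k))%C
  end.

Definition hyp4F3_term (a1 a2 a3 a4 b1 b2 b3 z : C) (n : nat) : C :=
  ((Cpoch a1 n * Cpoch a2 n * Cpoch a3 n * Cpoch a4 n)
     / (Cpoch b1 n * Cpoch b2 n * Cpoch b3 n)
   * (z ^ n / INR (Factorial.fact n)))%C.

Definition hyp4F3 (a1 a2 a3 a4 b1 b2 b3 z : C) : C :=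
  CSeries (hyp4F3_term a1 a2 a3 a4 b1 b2 b3 z).

(* The sum over m >= 1 is shifted to start at 0. *)
Definition Li3_term (z : C) (m : nat) : C := (z ^ S m / INR (S m) ^ 3)%C.

Definition Li3 (z : C) : C := CSeries (Li3_term z).

Lemma sum_n_Re_Im (u : nat -> C) (n : nat) :
  sum_n u n = (sum_n (fun k => Re (u k)) n, sum_n (fun k => Im (u k)) n).
Proof.
induction n as [|n IH].
- rewrite !sum_O. now destruct (u O).
- rewrite !sum_Sn, IH. reflexivity.
Qed.

Lemma CSeries_unique (u : nat -> C) (l : C) : is_series u l -> CSeries u = l.
Proof.
intros H. destruct l as [x y]. unfold CSeries. f_equal.
- apply is_series_unique.
  intros P [e He].
  destruct (H (fun c => P (fst c))) as [N HN].
  + exists e. intros c [Hc _]. exact (He _ Hc).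
  + exists N. intros n Hn. specialize (HN n Hn). cbv beta in HN.
    rewrite sum_n_Re_Im in HN. exact HN.
- apply is_series_unique.
  intros P [e He].
  destruct (H (fun c => P (snd c))) as [N HN].
  + exists e. intros c [_ Hc]. exact (He _ Hc).
  + exists N. intros n Hn. specialize (HN n Hn). cbv beta in HN.
    rewrite sum_n_Re_Im in HN. exact HN.
Qed.

Lemma CSeries_correct (u : nat -> C) : ex_series u -> is_series u (CSeries u).
Proof. intros [l Hl]. now rewrite (CSeries_unique u l Hl). Qed.

Lemma ex_series_inv_cube : ex_series (fun m => / INR (S m) ^ 3).
Proof.
apply (@ex_series_le R_AbsRing R_CompleteNormedModule _
         (fun m => 2 * (/ INR (S m) - / INR (S (S m))))).
- intros m.
  assert (Hx : 1 <= INR (S m)) by (rewrite S_INR; pose proof (pos_INR m); lra).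
  rewrite (S_INR (S m)). set (x := INR (S m)) in *.
  change (Rabs (/ x ^ 3) <= 2 * (/ x - / (x + 1))).
  assert (0 < x ^ 3) by (apply pow_lt; lra).
  rewrite Rabs_pos_eq by (left; apply Rinv_0_lt_compat; lra).
  replace (2 * (/ x - / (x + 1))) with (/ x ^ 3 + (2 * x ^ 2 - x - 1) / (x ^ 3 * (x + 1)))
    by (field; lra).
  assert (0 <= (2 * x ^ 2 - x - 1) / (x ^ 3 * (x + 1))); [|lra].
  apply Rmult_le_pos; [nra|].
  left; apply Rinv_0_lt_compat, Rmult_lt_0_compat; lra.
- exists (2 * (1 - 0)).
  apply (is_lim_seq_ext (fun n => 2 * (1 - / INR (S (S n))))
           (sum_n (fun m => 2 * (/ INR (S m) - / INR (S (S m))))) (2 * (1 - 0))).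
  + induction n as [|n IH].
    * rewrite sum_O. simpl. field.
    * rewrite sum_Sn, <- IH. unfold plus; simpl plus. cbn -[INR]. ring.
  + apply (is_lim_seq_scal_l _ 2 (1 - 0)).
    apply is_lim_seq_minus'; [apply is_lim_seq_const|].
    apply (is_lim_seq_incr_1 (fun n => / INR (S n))).
    apply (is_lim_seq_incr_1 (fun n => / INR n)).
    apply (is_lim_seq_inv INR p_infty is_lim_seq_INR). discriminate.
Qed.

Lemma ex_series_Li3 (z : C) : Cmod z <= 1 -> ex_series (Li3_term z).
Proof.
intros Hz.
apply (@ex_series_le C_AbsRing C_CompleteNormedModule _
         (fun m => / INR (S m) ^ 3)); [|exact ex_series_inv_cube].
intros m.
assert (Hm : 0 < INR (S m)) by (apply lt_0_INR; lia).
assert (Hp : 0 < INR (S m) ^ 3) by (apply pow_lt; exact Hm).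
change (Cmod (Li3_term z m) <= / INR (S m) ^ 3). unfold Li3_term.
rewrite <- RtoC_pow, Cmod_div, Cmod_pow, Cmod_R, (Rabs_pos_eq (INR (S m) ^ 3)).
- unfold Rdiv. rewrite <- (Rmult_1_l (/ _)) at 2.
  apply Rmult_le_compat_r; [left; now apply Rinv_0_lt_compat|].
  rewrite <- (pow1 (S m)). apply pow_incr. split; [apply Cmod_ge_0|exact Hz].
- lra.
- intros E. apply RtoC_inj in E. lra.
Qed.

(* Main.v *)
(* Put c_n = binom(2n,n)/4^n. Since c_n is (2/pi) times the integral of sin^(2n) over [0, pi/2], the sum is (2/pi) times the integral of
   g(t) = sum c_n sin^(2n) t/(2n+1)^2, where sin t g(t) is an antiderivative of t cot t. Integrating by parts and halving the angle turns
   this into the integral of x (cot x - tan x) ln(tan x) over [0, pi/4].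
   Three paths end at z = (1+i)/2: it/(1+it), 1/(1-it) and (1+it)/2 with t = tan x (the first two exchanged by x -> pi/2 - x). Along them
   the imaginary part of Li3 differs, by products of lower weight, from iterated integrals of ln(2 sin x), ln(2 cos x) and x; matching
   these words expresses the antiderivative sought as the sum of the three functions minus that of ln(2 sin x)^2. The latter is fixed
   at pi/4 by the third path, the reflection x -> pi/2 - x and the duplication sin 2x = 2 sin x cos x.
   The remaining constant Re Li2((1+i)/2) follows from Euler's reflection formula, Landen's formula and Re Li2(i) = - Li2(1)/8, which
   together also yield Li2(1) = pi^2/6. *)
Require Import Defs.
From Stdlib Require Import Reals Lra Lia.
From Coquelicot Require Import Coquelicot.
Open Scope R_scope.

(** * Series and polylogarithms *)

(** The obstacle lies at the ends of the paths. Polylogarithms are differentiated termwise only in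
    the open unit disc, whereas the reflected path starts at 1, the path for Landen's formula ends
    at i, and ln(2 sin x) blows up at 0. Across a singular end nothing is integrated: a combination
    with zero derivative is constant on the open interval, and its constant is read off from limits,
    which Tannery's theorem supplies on the closed disc. Branches of the logarithm never arise,
    since - log(1 - z) is identified on each path by a pair of real functions. At pi/4 everything
    becomes one linear equation. The integral of ln(tan x)^2 over [0, pi/4] is elementary, because
    the two exchanged paths carry the same trilogarithm there and enter it with opposite signs; this
    is what lets reflection and duplication determine the integral of ln(2 sin x)^2. The number Im
    Li2((1+i)/2) is never evaluated: its coefficients agree on both sides of the last equation. *)

Lemma ex_series_dominated (a M : nat -> R) :
  ex_series M -> (forall n, Rabs (a n) <= M n) -> ex_series a.
Proof.
intros HM Ha.
exact (@ex_series_le R_AbsRing R_CompleteNormedModule a M Ha HM).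
Qed.

Lemma Series_dominated (a M : nat -> R) :
  ex_series M -> (forall n, Rabs (a n) <= M n) -> Rabs (Series a) <= Series M.
Proof.
intros HM Ha.
eapply Rle_trans; [apply Series_Rabs|].
- apply (ex_series_dominated _ M HM). intros n. now rewrite Rabs_Rabsolu.
- apply Series_le; [|exact HM]. intros n. split; [apply Rabs_pos|apply Ha].
Qed.

Lemma Series_tail_small (M : nat -> R) (e : R) :
  ex_series M -> 0 < e ->
  exists N, Rabs (Series (fun k => M (S N + k)%nat)) < e.
Proof.
intros HM He.
pose proof (Series_correct M HM) as HS.
destruct (proj1 (filterlim_locally _ _) HS (mkposreal e He)) as [N HN].
exists N.
rewrite (Series_incr_n M (S N)) in HN; [|lia|exact HM].
specialize (HN N (le_n _)).
change (Rabs (sum_n M N - (sum_f_R0 M (Init.Nat.pred (S N)) + Series (fun k => M (S N + k)%nat))) < e) in HN.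
rewrite sum_n_Reals in HN. simpl Init.Nat.pred in HN.
rewrite <- Rabs_Ropp.
replace (- Series (fun k => M (S N + k)%nat)) with
  (sum_f_R0 M N - (sum_f_R0 M N + Series (fun k => M (S N + k)%nat))) by ring.
exact HN.
Qed.

(* Tannery's theorem. *)
Lemma filterlim_Series {T : Type} (F : (T -> Prop) -> Prop) {FF : Filter F}
  (f : nat -> T -> R) (l M : nat -> R) :
  ex_series M ->
  (forall n, Rabs (l n) <= M n) ->
  F (fun t => forall n, Rabs (f n t) <= M n) ->
  (forall n, filterlim (f n) F (locally (l n))) ->
  filterlim (fun t => Series (fun n => f n t)) F (locally (Series l)).
Proof.
intros HM Hl Hf Hlim.
apply filterlim_locally. intros eps.
assert (He : 0 < eps / 4) by (destruct eps; simpl; lra).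
destruct (Series_tail_small M _ HM He) as [N HN].
assert (HMt : ex_series (fun k => M (S N + k)%nat)) by (now apply ex_series_incr_n).
assert (Hsum : filterlim (fun t => sum_f_R0 (fun n => f n t) N) F
                 (locally (sum_f_R0 l N))).
{ clear HN HMt. induction N as [|N IH]; simpl.
  - apply Hlim.
  - apply (filterlim_comp_2 (G := locally (sum_f_R0 l N)) (H := locally (l (S N))) _ _ Rplus).
    + exact IH.
    + apply Hlim.
    + apply (filterlim_plus (sum_f_R0 l N) (l (S N))). }
generalize (filter_and _ _ Hf (proj1 (filterlim_locally _ _) Hsum (mkposreal _ He))).
apply filter_imp. intros t [Ht1 Ht2].
change (Rabs (Series (fun n => f n t) - Series l) < eps).
change (Rabs (sum_f_R0 (fun n => f n t) N - sum_f_R0 l N) < eps / 4) in Ht2.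
rewrite (Series_incr_n (fun n => f n t) (S N)); [|lia|now apply (ex_series_dominated _ M)].
rewrite (Series_incr_n l (S N)); [|lia|now apply (ex_series_dominated _ M)].
simpl Init.Nat.pred.
pose proof (Series_dominated (fun k => f (S N + k)%nat t) _ HMt (fun k => Ht1 (S N + k)%nat)) as H1.
pose proof (Series_dominated (fun k => l (S N + k)%nat) _ HMt (fun k => Hl (S N + k)%nat)) as H2.
revert Ht2 HN H1 H2.
generalize (sum_f_R0 (fun n => f n t) N) (sum_f_R0 l N)
  (Series (fun k => f (S N + k)%nat t)) (Series (fun k => l (S N + k)%nat))
  (Series (fun k => M (S N + k)%nat)).
intros a b c d e H1 H2 H3 H4.
apply Rabs_def2 in H1. apply Rabs_def2 in H2.
apply Rabs_le_between in H3. apply Rabs_le_between in H4.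
apply Rabs_def1; lra.
Qed.

(** Covers [Re] and [Im] at once: real-linear and of norm at most 1 is all that the termwise
    estimates and derivatives require. *)
Definition real_functional (p : C -> R) :=
  (forall a b : C, p (a + b)%C = p a + p b) /\
  (forall (r : R) (a : C), p (RtoC r * a)%C = r * p a) /\
  (forall a : C, Rabs (p a) <= Cmod a).

Lemma real_functional_Re : real_functional Re.
Proof.
split; [|split]; [intros [a1 a2] [b1 b2]; reflexivity|intros r [a1 a2]; unfold Re; simpl; ring|].
exact re_le_Cmod.
Qed.

Lemma real_functional_Im : real_functional Im.
Proof.
split; [|split]; [intros [a1 a2] [b1 b2]; reflexivity|intros r [a1 a2]; unfold Im; simpl; ring|].
intros a. eapply Rle_trans; [|apply Rmax_Cmod]. apply Rmax_r.
Qed.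

(* [p (Li_s z)], where [p] is [Re] or [Im]; the sum over [m >= 1] is shifted to start at 0. *)
Definition polylog (p : C -> R) (s : nat) (z : C) : R :=
  Series (fun m => p (z ^ S m)%C / INR (S m) ^ s).

Lemma INR_S_ge_1 (m : nat) : 1 <= INR (S m).
Proof. rewrite S_INR. pose proof (pos_INR m). lra. Qed.

Lemma pow_INR_S_ge_1 (m s : nat) : 1 <= INR (S m) ^ s.
Proof. apply pow_R1_Rle, INR_S_ge_1. Qed.

Lemma Rabs_div_le (a b c : R) : Rabs a <= b -> 1 <= c -> Rabs (a / c) <= b.
Proof.
intros Ha Hc. unfold Rdiv. rewrite Rabs_mult, Rabs_inv, (Rabs_pos_eq c) by lra.
apply Rle_div_l; [lra|]. pose proof (Rabs_pos a). nra.
Qed.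

(** * Termwise differentiation in the open unit disc *)

Lemma ex_series_succ_geom (q : R) : 0 < q < 1 ->
  ex_series (fun m => INR (S m) * q ^ S m).
Proof.
intros Hq.
apply ex_series_Rabs, (ex_series_DAlembert _ q); [lra| |].
- intros n. pose proof (INR_S_ge_1 n). pose proof (pow_lt q (S n) (proj1 Hq)). nra.
- apply (is_lim_seq_ext (fun n => q * (1 + / INR (S n)))).
  + intros n. pose proof (INR_S_ge_1 n) as H1. pose proof (pow_lt q (S n) (proj1 Hq)) as H2.
    rewrite (S_INR (S n)). change (q ^ S (S n)) with (q * q ^ S n).
    generalize dependent (q ^ S n). generalize dependent (INR (S n)). intros x Hx y Hy.
    replace ((x + 1) * (q * y) / (x * y)) with (q * (1 + / x)) by (field; lra).
    rewrite Rabs_pos_eq; [reflexivity|].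
    assert (0 < / x) by (apply Rinv_0_lt_compat; lra). nra.
  + replace (Finite q) with (Finite (q * (1 + 0))) by (f_equal; ring).
    apply (is_lim_seq_scal_l _ q (1 + 0)).
    apply is_lim_seq_plus'; [apply is_lim_seq_const|].
    apply (is_lim_seq_incr_1 (fun n => / INR n)).
    apply (is_lim_seq_inv INR p_infty is_lim_seq_INR). discriminate.
Qed.

(** The second-order remainder of the n-th power is at most n(n-1)/2 r^(n-2) |w - z|^2. The cruder
    factor n^2, with [r ^ 2] moved to the left, avoids truncated subtraction in the exponent and
    survives the induction. *)
Lemma Cpow_taylor_bound (z w : C) (r : R) (m : nat) :
  0 < r -> Cmod z <= r -> Cmod w <= r ->
  r ^ 2 * Cmod (w ^ S m - z ^ S m - RtoC (INR (S m)) * (z ^ m * (w - z)))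
   <= INR (S m) ^ 2 * r ^ S m * Cmod (w - z) ^ 2.
Proof.
intros Hr Hz Hw.
induction m as [|m IH].
- replace (w ^ 1 - z ^ 1 - RtoC (INR 1) * (z ^ 0 * (w - z)))%C with (RtoC 0)
    by (simpl; ring).
  rewrite Cmod_0. simpl. pose proof (Cmod_ge_0 (w - z)). nra.
- set (E := (w ^ S m - z ^ S m - RtoC (INR (S m)) * (z ^ m * (w - z)))%C) in *.
  replace (w ^ S (S m) - z ^ S (S m) - RtoC (INR (S (S m))) * (z ^ S m * (w - z)))%C
    with (w * E + RtoC (INR (S m)) * (z ^ m * ((w - z) * (w - z))))%C
    by (unfold E; rewrite (S_INR (S m)), RtoC_plus, !Cpow_S; ring).
  eapply Rle_trans.
  { apply Rmult_le_compat_l; [apply pow2_ge_0|]. apply Cmod_triangle. }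
  rewrite !Cmod_mult, Cmod_R, Cmod_pow, (Rabs_pos_eq (INR (S m))) by apply pos_INR.
  rewrite (S_INR (S m)).
  pose proof (INR_S_ge_1 m) as Hn. set (n := INR (S m)) in *.
  set (h := Cmod (w - z)) in *.
  assert (Hh : 0 <= h) by apply Cmod_ge_0.
  assert (HE : 0 <= Cmod E) by apply Cmod_ge_0.
  assert (Hzm : Cmod z ^ m <= r ^ m) by (apply pow_incr; split; [apply Cmod_ge_0|exact Hz]).
  assert (Hzm0 : 0 <= Cmod z ^ m) by (apply pow_le, Cmod_ge_0).
  assert (Hrm : 0 <= r ^ m) by (apply pow_le; lra).
  assert (A1 : r ^ 2 * (Cmod w * Cmod E) <= r * (n ^ 2 * r ^ S m * h ^ 2)).
  { apply Rle_trans with (r * (r ^ 2 * Cmod E)).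
    - assert (0 <= r ^ 2 * Cmod E) by (apply Rmult_le_pos; [apply pow2_ge_0|exact HE]). nra.
    - apply Rmult_le_compat_l; lra. }
  assert (A2 : r ^ 2 * (n * (Cmod z ^ m * (h * h))) <= r ^ 2 * (n * (r ^ m * (h * h)))).
  { apply Rmult_le_compat_l; [nra|]. apply Rmult_le_compat_l; [lra|].
    apply Rmult_le_compat_r; nra. }
  apply Rle_trans with (r * (n ^ 2 * r ^ S m * h ^ 2) + r ^ 2 * (n * (r ^ m * (h * h)))).
  { rewrite Rmult_plus_distr_l. lra. }
  simpl pow.
  assert (0 <= r * r * r ^ m * (h * h)) by (repeat apply Rmult_le_pos; lra).
  nra.
Qed.

Lemma ex_series_polylog_lt (p : C -> R) (s : nat) (z : C) :
  real_functional p -> Cmod z < 1 ->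
  ex_series (fun m => p (z ^ S m)%C / INR (S m) ^ s).
Proof.
intros [_ [_ Hp]] Hz.
apply (ex_series_dominated _ (fun m => Cmod z ^ S m)).
- apply (ex_series_incr_1 (fun m => Cmod z ^ m)), ex_series_geom.
  rewrite Rabs_pos_eq; [exact Hz|apply Cmod_ge_0].
- intros m. apply Rabs_div_le; [|apply pow_INR_S_ge_1].
  rewrite <- Cmod_pow. apply Hp.
Qed.

Lemma ex_series_polylog_diff (p : C -> R) (s : nat) (z h : C) :
  real_functional p -> Cmod z < 1 ->
  ex_series (fun m => p (z ^ m * h)%C / INR (S m) ^ s).
Proof.
intros [_ [_ Hp]] Hz.
apply (ex_series_dominated _ (fun m => Cmod z ^ m * Cmod h)).
- apply ex_series_scal_r, ex_series_geom.
  rewrite Rabs_pos_eq; [exact Hz|apply Cmod_ge_0].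
- intros m. apply Rabs_div_le; [|apply pow_INR_S_ge_1].
  rewrite <- Cmod_pow, <- Cmod_mult. apply Hp.
Qed.

(** The factor n^2 of the power remainder loses one n to the denominator n^(s+1), and the sum of n
    r^n converges; the constant is thus uniform on the disc of radius r. *)
Lemma polylog_taylor_bound (p : C -> R) (s : nat) (r : R) :
  real_functional p -> 0 < r < 1 ->
  exists K, 0 < K /\ forall z w : C, Cmod z <= r -> Cmod w <= r ->
  Rabs (polylog p (S s) w - polylog p (S s) z
        - Series (fun m => p (z ^ m * (w - z))%C / INR (S m) ^ s))
  <= K * Cmod (w - z) ^ 2.
Proof.
intros Hp Hr.
pose proof (ex_series_succ_geom r Hr) as HM.
set (K0 := Series (fun m => INR (S m) * r ^ S m)).
exists (Rabs K0 / r ^ 2 + 1).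
assert (Hr2 : 0 < r ^ 2) by (apply pow_lt; lra).
split.
{ pose proof (Rabs_pos K0).
  assert (0 <= Rabs K0 / r ^ 2) by (apply Rdiv_le_0_compat; lra). lra. }
intros z w Hz Hw.
unfold polylog.
rewrite <- Series_minus by (apply ex_series_polylog_lt; [exact Hp|lra]).
rewrite <- Series_minus.
2: { apply (@ex_series_minus R_AbsRing R_NormedModule); apply ex_series_polylog_lt; [exact Hp|lra|exact Hp|lra]. }
2: { apply ex_series_polylog_diff; [exact Hp|lra]. }
set (h := Cmod (w - z)).
assert (Hh : 0 <= h) by apply Cmod_ge_0.
eapply Rle_trans.
- apply (Series_dominated _ (fun m => INR (S m) * r ^ S m * (h ^ 2 / r ^ 2))).
  + now apply ex_series_scal_r.
  + intros m.
    pose proof (Cpow_taylor_bound z w r m (proj1 Hr) Hz Hw) as HT. fold h in HT.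
    destruct Hp as [Hadd [Hscal Hb]].
    set (E := (w ^ S m - z ^ S m - RtoC (INR (S m)) * (z ^ m * (w - z)))%C) in *.
    pose proof (INR_S_ge_1 m) as Hn. pose proof (pow_INR_S_ge_1 m s) as Hns.
    assert (HE : p (w ^ S m)%C = p (z ^ S m)%C + INR (S m) * p (z ^ m * (w - z))%C + p E).
    { rewrite <- Hscal, <- !Hadd. f_equal. unfold E. ring. }
    rewrite HE. change (INR (S m) ^ S s) with (INR (S m) * INR (S m) ^ s).
    set (n := INR (S m)) in *. set (ns := n ^ s) in *.
    replace ((p (z ^ S m)%C + n * p (z ^ m * (w - z))%C + p E) / (n * ns) -
       p (z ^ S m)%C / (n * ns) - p (z ^ m * (w - z))%C / ns) with ((p E / n) / ns)
       by (field; lra).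
    apply Rabs_div_le; [|exact Hns].
    unfold Rdiv. rewrite Rabs_mult, Rabs_inv, (Rabs_pos_eq n) by lra.
    apply Rle_div_l; [lra|].
    eapply Rle_trans; [apply Hb|].
    apply Rmult_le_reg_l with (r ^ 2); [exact Hr2|].
    eapply Rle_trans; [exact HT|]. right. field. lra.
- rewrite Series_scal_r. fold K0.
  replace (K0 * (h ^ 2 / r ^ 2)) with (K0 / r ^ 2 * h ^ 2) by (field; lra).
  apply Rmult_le_compat_r; [apply pow2_ge_0|].
  assert (K0 / r ^ 2 <= Rabs K0 / r ^ 2).
  { apply Rmult_le_compat_r; [left; now apply Rinv_0_lt_compat|apply RRle_abs]. }
  lra.
Qed.

(** The polylogarithm is treated as a differentiable function of two real variables, to which the
    chain rule applies. The series is p of Li_s(z) z'/z with the division by z done termwise, so it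
    makes sense at z = 0 too. *)
Lemma is_derive_polylog_path (p : C -> R) (s : nat) (x y : R -> R) (t dx dy : R) :
  real_functional p -> is_derive x t dx -> is_derive y t dy ->
  Cmod (x t, y t) < 1 ->
  is_derive (fun t => polylog p (S s) (x t, y t)) t
    (Series (fun m => p ((x t, y t) ^ m * (dx, dy))%C / INR (S m) ^ s)).
Proof.
intros Hp Hx Hy Hz.
apply is_derive_Reals. apply is_derive_Reals in Hx. apply is_derive_Reals in Hy.
set (z := (x t, y t) : C) in *.
set (r := (1 + Cmod z) / 2).
pose proof (Cmod_ge_0 z) as Hz0.
assert (Hr : 0 < r < 1) by (unfold r; lra).
destruct (polylog_taylor_bound p s r Hp Hr) as [K [HK HT]].
pose proof Hp as [Hadd [Hscal Hb]].
set (lx := Series (fun m => p (z ^ m * 1)%C / INR (S m) ^ s)).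
set (ly := Series (fun m => p (z ^ m * Ci)%C / INR (S m) ^ s)).
assert (Hlin : forall a b : R,
  Series (fun m => p (z ^ m * (a, b))%C / INR (S m) ^ s) = lx * a + ly * b).
{ intros a b. unfold lx, ly. rewrite <- !Series_scal_r.
  rewrite <- Series_plus.
  - apply Series_ext. intros m.
    replace (z ^ m * (a, b))%C with (RtoC a * (z ^ m * 1) + RtoC b * (z ^ m * Ci))%C.
    + rewrite Hadd, !Hscal. unfold Rdiv. ring.
    + replace (a, b) with (RtoC a + RtoC b * Ci)%C; [ring|].
      unfold RtoC, Ci, Cplus, Cmult; simpl; f_equal; ring.
  - apply ex_series_scal_r, ex_series_polylog_diff; assumption.
  - apply ex_series_scal_r, ex_series_polylog_diff; assumption. }
rewrite Hlin.
apply (derivable_pt_lim_comp_2d (fun u v => polylog p (S s) (u, v)) x y t); [|exact Hx|exact Hy].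
intros eps.
(* The first bound keeps the moving point in the disc of radius [r], since its distance to z is at
   most sqrt 2 M with sqrt 2 < 2. The second turns the error, at most 2 K M^2, into at most eps
   M. *)
assert (Hd : 0 < Rmin ((1 - Cmod z) / 4) (eps / (2 * K))).
{ apply Rmin_glb_lt; [lra|]. apply Rdiv_lt_0_compat; [apply cond_pos|lra]. }
exists (mkposreal _ Hd). intros u v Hu Hv. simpl in Hu, Hv.
set (M := Rmax (Rabs (u - x t)) (Rabs (v - y t))).
assert (HM : M < Rmin ((1 - Cmod z) / 4) (eps / (2 * K))) by (apply Rmax_lub_lt; assumption).
assert (HM1 : M < (1 - Cmod z) / 4) by (eapply Rlt_le_trans; [exact HM|apply Rmin_l]).
assert (HM2 : M < eps / (2 * K)) by (eapply Rlt_le_trans; [exact HM|apply Rmin_r]).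
assert (HM0 : 0 <= M) by (eapply Rle_trans; [apply Rabs_pos|apply Rmax_l]).
assert (Hdiff : ((u, v) - z)%C = (u - x t, v - y t)) by reflexivity.
assert (Hmod : Cmod ((u, v) - z)%C <= sqrt 2 * M).
{ rewrite Hdiff. apply (Cmod_2Rmax (u - x t, v - y t)). }
assert (H2 : sqrt 2 * sqrt 2 = 2) by (apply sqrt_sqrt; lra).
assert (H2p : 0 < sqrt 2) by (apply sqrt_lt_R0; lra).
assert (Hs2 : sqrt 2 < 2) by nra.
assert (Hw : Cmod (u, v) <= r).
{ replace ((u, v) : C) with (z + ((u, v) - z))%C by ring.
  eapply Rle_trans; [apply Cmod_triangle|]. unfold r. nra. }
assert (Hzr : Cmod z <= r) by (unfold r; lra).
specialize (HT z (u, v) Hzr Hw).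
rewrite Hdiff in HT, Hmod. rewrite Hlin in HT.
eapply Rle_trans; [exact HT|].
assert (Hsq : Cmod (u - x t, v - y t) ^ 2 <= 2 * M * M).
{ pose proof (Cmod_ge_0 (u - x t, v - y t)). simpl. nra. }
apply Rle_trans with (K * (2 * M * M)).
{ apply Rmult_le_compat_l; lra. }
apply Rlt_div_r in HM2; [|lra]. 
replace (K * (2 * M * M)) with (M * (2 * K) * M) by ring.
apply Rmult_le_compat_r; lra.
Qed.

(** The hypotheses on [x] and [y] say z' = z (a + i b), so [a] and [b] are the parts of the
    logarithmic derivative of the path and Li_(s+1)(z)' = Li_s(z) (a + i b). *)
Lemma is_derive_polylog_Re (s : nat) (x y : R -> R) (t a b : R) :
  is_derive x t (x t * a - y t * b) -> is_derive y t (x t * b + y t * a) ->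
  Cmod (x t, y t) < 1 ->
  is_derive (fun t => polylog Re (S s) (x t, y t)) t
    (polylog Re s (x t, y t) * a - polylog Im s (x t, y t) * b).
Proof.
intros Hx Hy Hz.
pose proof (is_derive_polylog_path Re s x y t _ _ real_functional_Re Hx Hy Hz) as H.
match goal with |- is_derive _ _ ?v => match type of H with is_derive _ _ ?u =>
  replace v with u; [exact H|] end end.
unfold polylog. rewrite <- !Series_scal_r, <- Series_minus.
- apply Series_ext. intros m. unfold Rdiv.
  change ((x t, y t) ^ S m)%C with ((x t, y t) * (x t, y t) ^ m)%C.
  destruct ((x t, y t) ^ m)%C as [u v]. unfold Re, Im. simpl fst. simpl snd. ring.
- apply ex_series_scal_r, ex_series_polylog_lt; [apply real_functional_Re|exact Hz].
- apply ex_series_scal_r, ex_series_polylog_lt; [apply real_functional_Im|exact Hz].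
Qed.

Lemma is_derive_polylog_Im (s : nat) (x y : R -> R) (t a b : R) :
  is_derive x t (x t * a - y t * b) -> is_derive y t (x t * b + y t * a) ->
  Cmod (x t, y t) < 1 ->
  is_derive (fun t => polylog Im (S s) (x t, y t)) t
    (polylog Re s (x t, y t) * b + polylog Im s (x t, y t) * a).
Proof.
intros Hx Hy Hz.
pose proof (is_derive_polylog_path Im s x y t _ _ real_functional_Im Hx Hy Hz) as H.
match goal with |- is_derive _ _ ?v => match type of H with is_derive _ _ ?u =>
  replace v with u; [exact H|] end end.
unfold polylog. rewrite <- !Series_scal_r, <- Series_plus.
- apply Series_ext. intros m. unfold Rdiv.
  change ((x t, y t) ^ S m)%C with ((x t, y t) * (x t, y t) ^ m)%C.
  destruct ((x t, y t) ^ m)%C as [u v]. unfold Re, Im. simpl fst. simpl snd. ring.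
- apply ex_series_scal_r, ex_series_polylog_lt; [apply real_functional_Re|exact Hz].
- apply ex_series_scal_r, ex_series_polylog_lt; [apply real_functional_Im|exact Hz].
Qed.

(** * The polylogarithm of order 1 as a logarithm *)

Lemma Cmod_lt_1 (x y : R) : x ^ 2 + y ^ 2 < 1 -> Cmod (x, y) < 1.
Proof.
intros H. unfold Cmod. simpl fst. simpl snd.
rewrite <- sqrt_1. apply sqrt_lt_1; [|lra|exact H].
pose proof (pow2_ge_0 x). pose proof (pow2_ge_0 y). lra.
Qed.

Lemma Cmod_le_1 (x y : R) : x ^ 2 + y ^ 2 <= 1 -> Cmod (x, y) <= 1.
Proof.
intros H. unfold Cmod. simpl fst. simpl snd.
rewrite <- sqrt_1. now apply sqrt_le_1_alt.
Qed.

(** This is the derivative series for s = 0; the denominator with exponent 0 is kept so that both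
    have the same form. *)
Lemma Series_Cgeom (p : C -> R) (z h : C) :
  real_functional p -> Cmod z < 1 ->
  Series (fun m => p (z ^ m * h)%C / INR (S m) ^ 0) = p (h / (1 - z))%C.
Proof.
intros Hp Hz. pose proof Hp as [Hadd [Hscal Hb]].
assert (Hnz : (1 - z)%C <> RtoC 0).
{ intros E. assert (z = RtoC 1) by (replace z with (1 - (1 - z))%C by ring; rewrite E; ring).
  subst z. rewrite Cmod_1 in Hz. lra. }
assert (Hsum : forall n, sum_n (fun m => p (z ^ m * h)%C / INR (S m) ^ 0) n
   = p (h / (1 - z))%C + p (- (h / (1 - z)) * z ^ S n)%C).
{ intros n. rewrite <- Hadd. induction n as [|n IH].
  - rewrite sum_O. simpl (_ ^ 0). unfold Rdiv. rewrite Rinv_1, Rmult_1_r. f_equal.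
    simpl. field. exact Hnz.
  - rewrite sum_Sn, IH. change plus with Rplus. simpl (_ ^ 0). unfold Rdiv.
    rewrite Rinv_1, Rmult_1_r, <- Hadd. f_equal.
    simpl. field. exact Hnz. }
apply is_series_unique.
unfold is_series.
apply (is_lim_seq_ext (fun n => p (h / (1 - z))%C + p (- (h / (1 - z)) * z ^ S n)%C) _ (p (h / (1 - z))%C)).
{ intros n. now rewrite Hsum. }
replace (Finite (p (h / (1 - z))%C)) with (Finite (p (h / (1 - z))%C + 0)) by (f_equal; ring).
apply is_lim_seq_plus'; [apply is_lim_seq_const|].
apply is_lim_seq_abs_0.
apply (is_lim_seq_le_le (fun _ => 0) _ (fun n => Cmod (h / (1 - z)) * Cmod z ^ S n)).
- intros n. split; [apply Rabs_pos|]. eapply Rle_trans; [apply Hb|].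
  rewrite Cmod_mult, Cmod_opp, Cmod_pow. lra.
- apply is_lim_seq_const.
- replace (Finite 0) with (Finite (Cmod (h / (1 - z)) * 0)) by (f_equal; ring).
  apply (is_lim_seq_scal_l _ _ 0).
  apply (is_lim_seq_incr_1 (fun n => Cmod z ^ n)).
  apply is_lim_seq_geom. rewrite Rabs_pos_eq; [exact Hz|apply Cmod_ge_0].
Qed.

Lemma polylog_0_r (p : C -> R) (s : nat) : real_functional p -> polylog p s 0 = 0.
Proof.
intros [_ [Hscal _]]. unfold polylog.
(* A zero sum is written as 0 times a series, because [Series_scal_l] asks for no convergence. *)
transitivity (0 * Series (fun _ : nat => 0)); [|ring].
rewrite <- Series_scal_l. apply Series_ext. intros m.
replace (0 ^ S m)%C with (RtoC 0 * RtoC 0)%C by (simpl; ring).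
rewrite Hscal. unfold Rdiv. ring.
Qed.

Lemma eq_of_derive (f g df : R -> R) (a b : R) : a <= b ->
  (forall t, a <= t <= b -> is_derive f t (df t)) ->
  (forall t, a <= t <= b -> is_derive g t (df t)) ->
  f a = g a -> f b = g b.
Proof.
intros Hab Hf Hg H0.
destruct (Rle_lt_or_eq_dec a b Hab) as [Hlt|<-]; [|exact H0].
enough (f a - g a = f b - g b) by lra.
apply (eq_is_derive (fun t => f t - g t)); [|exact Hlt].
intros t Ht.
pose proof (is_derive_minus f g t (df t) (df t) (Hf t Ht) (Hg t Ht)) as H.
now rewrite minus_eq_zero in H.
Qed.

(** Li_1(z) = - log(1 - z), by comparing derivatives along the segment from 0 to z. The real part of
    1 - z stays positive there, so [atan] gives the argument without branch correction. *)
Lemma polylog_1 (x y : R) : x ^ 2 + y ^ 2 < 1 ->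
  polylog Re 1 (x, y) = - ln ((1 - x) ^ 2 + y ^ 2) / 2 /\
  polylog Im 1 (x, y) = atan (y / (1 - x)).
Proof.
intros Hxy.
assert (Hx : x < 1) by nra.
assert (Hseg : forall t, 0 <= t <= 1 -> (t * x) ^ 2 + (t * y) ^ 2 < 1).
{ intros t Ht. assert (t ^ 2 <= 1) by nra. pose proof (pow2_ge_0 x). pose proof (pow2_ge_0 y).
  replace ((t * x) ^ 2 + (t * y) ^ 2) with (t ^ 2 * (x ^ 2 + y ^ 2)) by ring.
  pose proof (pow2_ge_0 t). nra. }
assert (Hd : forall t, 0 <= t <= 1 -> 0 < 1 - t * x).
{ intros t Ht. destruct (Req_dec t 1) as [->|Hne]; [lra|].
  assert (0 <= t * (1 - x)) by nra. lra. }
assert (HN : forall t, 0 <= t <= 1 -> 0 < (1 - t * x) ^ 2 + (t * y) ^ 2).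
{ intros t Ht. specialize (Hd t Ht). pose proof (pow2_ge_0 (t * y)). nra. }
assert (Hp : forall p, real_functional p -> forall t, 0 <= t <= 1 ->
  is_derive (fun t => polylog p 1 (t * x, t * y)) t (p ((x, y) / (1 - ((t * x)%R, (t * y)%R)))%C)).
{ intros p Hp t Ht.
  rewrite <- Series_Cgeom; [|exact Hp|now apply Cmod_lt_1, Hseg].
  apply (is_derive_polylog_path p 0 (fun t => t * x) (fun t => t * y)); [exact Hp| | |now apply Cmod_lt_1, Hseg].
  - auto_derive; [trivial|ring].
  - auto_derive; [trivial|ring]. }
assert (H00 : forall p, real_functional p -> polylog p 1 (0 * x, 0 * y) = 0).
{ intros p Hpp. rewrite !Rmult_0_l. now apply polylog_0_r. }
assert (Hdiv : forall t, 0 <= t <= 1 -> ((x, y) / (1 - ((t * x)%R, (t * y)%R)))%C =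
   ((x * (1 - t * x) - t * y ^ 2) / ((1 - t * x) ^ 2 + (t * y) ^ 2),
    y / ((1 - t * x) ^ 2 + (t * y) ^ 2))).
{ intros t Ht. specialize (HN t Ht). unfold Cdiv, Cinv, Cmult, Cminus, Cplus, Copp, RtoC. simpl.
  f_equal; field; simpl in HN; nra. }
split.
- rewrite <- (Rmult_1_l x), <- (Rmult_1_l y).
  apply (eq_of_derive (fun t => polylog Re 1 (t * x, t * y))
    (fun t => - ln ((1 - t * x) ^ 2 + (t * y) ^ 2) / 2)
    (fun t => Re ((x, y) / (1 - ((t * x)%R, (t * y)%R)))%C) 0 1); [lra| | |].
  + intros t Ht. apply Hp; [apply real_functional_Re|exact Ht].
  + intros t Ht. rewrite Hdiv by exact Ht. unfold Re. simpl fst. specialize (HN t Ht).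
    auto_derive; [simpl in HN; lra|]. field. simpl in HN |- *. lra.
  + cbv beta. rewrite H00 by apply real_functional_Re.
    replace ((1 - 0 * x) ^ 2 + (0 * y) ^ 2) with 1 by ring. rewrite ln_1. field.
- rewrite <- (Rmult_1_l x), <- (Rmult_1_l y).
  apply (eq_of_derive (fun t => polylog Im 1 (t * x, t * y))
    (fun t => atan (t * y / (1 - t * x)))
    (fun t => Im ((x, y) / (1 - ((t * x)%R, (t * y)%R)))%C) 0 1); [lra| | |].
  + intros t Ht. apply Hp; [apply real_functional_Im|exact Ht].
  + intros t Ht. rewrite Hdiv by exact Ht. unfold Im. simpl snd. specialize (HN t Ht). specialize (Hd t Ht).
    auto_derive; [lra|]. field. simpl in HN |- *. repeat split; nra.
  + cbv beta. rewrite H00 by apply real_functional_Im.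
    replace (0 * y / (1 - 0 * x)) with 0 by (unfold Rdiv; ring). now rewrite atan_0.
Qed.

(** * Bounds and continuity on the closed unit disc *)

Lemma ex_series_inv_pow (s : nat) : (2 <= s)%nat -> ex_series (fun m => / INR (S m) ^ s).
Proof.
intros Hs.
(* Telescoping majorant: 1/x^2 <= 2/(x (x+1)) for x >= 1. *)
apply (ex_series_dominated _ (fun m => 2 * (/ INR (S m) - / INR (S (S m))))).
- exists (2 * (1 - 0)).
  apply (is_lim_seq_ext (fun n => 2 * (1 - / INR (S (S n))))
           (sum_n (fun m => 2 * (/ INR (S m) - / INR (S (S m))))) (2 * (1 - 0))).
  + induction n as [|n IH].
    * rewrite sum_O. simpl. field.
    * rewrite sum_Sn, <- IH. unfold plus; simpl plus. cbn -[INR]. ring.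
  + apply (is_lim_seq_scal_l _ 2 (1 - 0)).
    apply is_lim_seq_minus'; [apply is_lim_seq_const|].
    apply (is_lim_seq_incr_1 (fun n => / INR (S n))).
    apply (is_lim_seq_incr_1 (fun n => / INR n)).
    apply (is_lim_seq_inv INR p_infty is_lim_seq_INR). discriminate.
- intros m. pose proof (INR_S_ge_1 m) as Hx.
  rewrite (S_INR (S m)). set (x := INR (S m)) in *.
  assert (Hx2 : x ^ 2 <= x ^ s) by (apply Rle_pow; assumption).
  assert (0 < x ^ 2) by (apply pow_lt; lra).
  rewrite Rabs_pos_eq by (left; apply Rinv_0_lt_compat; lra).
  apply Rle_trans with (/ x ^ 2); [apply Rinv_le_contravar; lra|].
  replace (2 * (/ x - / (x + 1))) with (/ x ^ 2 + (x - 1) / (x ^ 2 * (x + 1)))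
    by (field; lra).
  assert (0 <= (x - 1) / (x ^ 2 * (x + 1))); [|lra].
  apply Rdiv_le_0_compat; [lra|]. apply Rmult_lt_0_compat; lra.
Qed.

Lemma polylog_term_bound (p : C -> R) (s m : nat) (z : C) :
  real_functional p -> Cmod z <= 1 ->
  Rabs (p (z ^ S m)%C / INR (S m) ^ s) <= / INR (S m) ^ s * Cmod z.
Proof.
intros [_ [_ Hb]] Hz.
pose proof (pow_INR_S_ge_1 m s).
unfold Rdiv. rewrite Rabs_mult, Rabs_inv, (Rabs_pos_eq (_ ^ _)) by lra.
rewrite Rmult_comm. apply Rmult_le_compat_l; [left; apply Rinv_0_lt_compat; lra|].
eapply Rle_trans; [apply Hb|]. rewrite Cmod_pow. simpl.
apply Rle_trans with (Cmod z * 1); [|lra]. apply Rmult_le_compat_l; [apply Cmod_ge_0|].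
rewrite <- (pow1 m). apply pow_incr. split; [apply Cmod_ge_0|exact Hz].
Qed.

(** Being linear in |z|, the bound beats the logarithms that multiply dilogarithms where a path
    leaves 0. *)
Lemma polylog_bound (p : C -> R) (s : nat) (z : C) :
  real_functional p -> (2 <= s)%nat -> Cmod z <= 1 ->
  Rabs (polylog p s z) <= Series (fun m => / INR (S m) ^ s) * Cmod z.
Proof.
intros Hp Hs Hz. rewrite <- Series_scal_r.
apply Series_dominated; [now apply ex_series_scal_r, ex_series_inv_pow|].
intros m. now apply polylog_term_bound.
Qed.

(** Tannery's theorem with majorant 1/n^s. It reaches the unit circle, in particular the points 1
    and i, where the differentiation lemmas stop. *)
Lemma filterlim_polylog {T : Type} (F : (T -> Prop) -> Prop) {FF : Filter F}
  (p : C -> R) (s : nat) (x y : T -> R) (x0 y0 : R) :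
  real_functional p -> (2 <= s)%nat ->
  F (fun t => Cmod (x t, y t) <= 1) -> Cmod (x0, y0) <= 1 ->
  filterlim x F (locally x0) -> filterlim y F (locally y0) ->
  filterlim (fun t => polylog p s (x t, y t)) F (locally (polylog p s (x0, y0))).
Proof.
intros Hp Hs Hz Hz0 Hx Hy. pose proof Hp as [Hadd [Hscal Hb]].
assert (Hbd : forall z m, Cmod z <= 1 -> Rabs (p (z ^ S m)%C / INR (S m) ^ s) <= / INR (S m) ^ s).
{ intros z m Hzz. pose proof (pow_INR_S_ge_1 m s).
  eapply Rle_trans; [now apply polylog_term_bound|].
  apply Rle_trans with (/ INR (S m) ^ s * 1); [|lra]. apply Rmult_le_compat_l; [|exact Hzz].
  left; apply Rinv_0_lt_compat; lra. }
unfold polylog. apply (filterlim_Series F _ _ (fun m => / INR (S m) ^ s)).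
- now apply ex_series_inv_pow.
- intros m. now apply Hbd.
- revert Hz. apply filter_imp. intros t Ht m. now apply Hbd.
- intros m. apply (filterlim_comp T R R _ (fun u => u / INR (S m) ^ s) F (locally (p ((x0, y0) ^ S m)%C))).
  2: { apply (@filterlim_scal_l R_AbsRing R_NormedModule (p ((x0, y0) ^ S m)%C)). }
  (* A real-linear functional is determined by its values at 1 and i, so convergence of both
     coordinates suffices. *)
  assert (Hlin : forall z : C, p z = fst z * p 1 + snd z * p Ci).
  { intros [a b]. simpl fst. simpl snd. rewrite <- !Hscal, <- Hadd. f_equal.
    unfold RtoC, Ci, Cplus, Cmult; simpl; f_equal; ring. }
  assert (Hmul : forall (f g : T -> R) a b, filterlim f F (locally a) -> filterlim g F (locally b) ->
      filterlim (fun t => f t * g t) F (locally (a * b))).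
  { intros f g a b Hf Hg. apply (filterlim_comp_2 (G := locally a) (H := locally b) f g Rmult Hf Hg).
    apply (@filterlim_mult R_AbsRing a b). }
  assert (Hpl : forall (f g : T -> R) a b, filterlim f F (locally a) -> filterlim g F (locally b) ->
      filterlim (fun t => f t + g t) F (locally (a + b))).
  { intros f g a b Hf Hg. apply (filterlim_comp_2 (G := locally a) (H := locally b) f g Rplus Hf Hg).
    apply (@filterlim_plus R_AbsRing R_NormedModule a b). }
  assert (Hop : forall (f : T -> R) a, filterlim f F (locally a) ->
      filterlim (fun t => - f t) F (locally (- a))).
  { intros f a Hf. apply (filterlim_comp _ _ _ f Ropp F (locally a)); [exact Hf|].
    apply (@filterlim_opp R_AbsRing R_NormedModule a). }
  assert (Hcomp : forall n, filterlim (fun t => fst ((x t, y t) ^ n)%C) F (locally (fst ((x0, y0) ^ n)%C)) /\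
      filterlim (fun t => snd ((x t, y t) ^ n)%C) F (locally (snd ((x0, y0) ^ n)%C))).
  { induction n as [|n [IH1 IH2]].
    - simpl. split; apply filterlim_const.
    - simpl. split.
      + apply (Hpl (fun t => _) (fun t => _)); [now apply Hmul|]. now apply Hop, Hmul.
      + apply (Hpl (fun t => _) (fun t => _)); now apply Hmul. }
  destruct (Hcomp (S m)) as [H1 H2].
  rewrite (Hlin ((x0, y0) ^ S m)%C).
  apply (filterlim_ext (fun t => fst ((x t, y t) ^ S m)%C * p 1 + snd ((x t, y t) ^ S m)%C * p Ci)).
  { intros t. symmetry. apply Hlin. }
  apply (Hpl (fun t => _) (fun t => _)); (apply (Hmul (fun t => _) (fun t => _)); [assumption|apply filterlim_const]).
Qed.

(** * Polylogarithms along the paths *)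

(* With [z = arc_path x]: [z = i tan x / (1 + i tan x)], [- log (1 - z) = - ln (cos x) + i x], [dz/z = (cot x - i) dx]. *)
Definition arc_path (x : R) : C := (sin x ^ 2, sin x * cos x).
(* With [z = line_path x]: [z = (1 + i tan x) / 2], [- log (1 - z) = lcos x + i x], [dz/z = (tan x + i) dx]. *)
Definition line_path (x : R) : C := (1 / 2, sin x / (2 * cos x)).
(** For w = - i tan x, Landen's transform w/(w - 1) is [arc_path x]; Re Li2 takes the same value at
    w and at its conjugate, the point used here. *)
Definition imag_path (x : R) : C := (0, sin x / cos x).

(** The factor 2 in both logarithms makes duplication free of constants:
    [lsin (2 * x) = lsin x + lcos x]. *)
Definition lsin (x : R) : R := ln (2 * sin x).
Definition lcos (x : R) : R := ln (2 * cos x).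

Lemma sin_cos_sq (x : R) : sin x ^ 2 + cos x ^ 2 = 1.
Proof. pose proof (sin2_cos2 x) as H. unfold Rsqr in H. simpl. lra. Qed.

Lemma ln_double (u : R) : 0 < u -> ln (2 * u) = ln 2 + ln u.
Proof. intros H. apply ln_mult; lra. Qed.

Lemma ln_sq (u : R) : 0 < u -> ln (u ^ 2) = 2 * ln u.
Proof. intros H. replace (u ^ 2) with (u * u) by ring. rewrite ln_mult by lra. ring. Qed.

Lemma atan_sin_cos (x : R) : - (PI / 2) < x < PI / 2 -> atan (sin x / cos x) = x.
Proof. intros Hx. apply atan_tan; lra. Qed.

Lemma trig_pos (x : R) : 0 < x < PI / 2 -> 0 < sin x /\ 0 < cos x.
Proof. intros Hx. split; [apply sin_gt_0; lra|apply cos_gt_0; lra]. Qed.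

Lemma is_derive_lsin (x : R) : 0 < sin x -> is_derive lsin x (cos x / sin x).
Proof. intros Hs. unfold lsin. auto_derive; [lra|]. field. lra. Qed.

Lemma is_derive_lcos (x : R) : 0 < cos x -> is_derive lcos x (- (sin x / cos x)).
Proof. intros Hs. unfold lcos. auto_derive; [lra|]. field. lra. Qed.

Lemma arc_path_lt_1 (x : R) (Hx : 0 < x < PI / 2) : (sin x ^ 2) ^ 2 + (sin x * cos x) ^ 2 < 1.
Proof. destruct (trig_pos x Hx) as [Hs Hc]. pose proof (sin_cos_sq x). nra. Qed.

Lemma arc_path_log (x : R) (Hx : 0 < x < PI / 2) : polylog Re 1 (arc_path x) = ln 2 - lcos x /\ polylog Im 1 (arc_path x) = x.
Proof.
destruct (trig_pos x Hx) as [Hs Hc].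
destruct (polylog_1 (sin x ^ 2) (sin x * cos x) (arc_path_lt_1 x Hx)) as [H1 H2].
unfold arc_path. rewrite H1, H2.
pose proof (sin_cos_sq x) as E.
replace (1 - sin x ^ 2) with (cos x ^ 2) by lra.
split.
- replace ((cos x ^ 2) ^ 2 + (sin x * cos x) ^ 2) with (cos x ^ 2)
    by (replace ((cos x ^ 2) ^ 2 + (sin x * cos x) ^ 2) with (cos x ^ 2 * (sin x ^ 2 + cos x ^ 2)) by ring;
        rewrite E; ring).
  unfold lcos. rewrite ln_sq, ln_double by exact Hc. field.
- replace (sin x * cos x / cos x ^ 2) with (sin x / cos x) by (field; lra).
  apply atan_sin_cos. lra.
Qed.

Lemma is_derive_arc_path_Re (x : R) (Hx : 0 < x < PI / 2) : is_derive (fun t => sin t ^ 2) x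
  (sin x ^ 2 * (cos x / sin x) - sin x * cos x * -1).
Proof. destruct (trig_pos x Hx) as [Hs Hc]. auto_derive; [trivial|]. field. lra. Qed.

Lemma is_derive_arc_path_Im (x : R) (Hx : 0 < x < PI / 2) : is_derive (fun t => sin t * cos t) x
  (sin x ^ 2 * -1 + sin x * cos x * (cos x / sin x)).
Proof. destruct (trig_pos x Hx) as [Hs Hc]. auto_derive; [trivial|]. field. lra. Qed.

Lemma is_derive_arc_Re (x : R) (Hx : 0 < x < PI / 2) (s : nat) : is_derive (fun t => polylog Re (S s) (arc_path t)) x
   (polylog Re s (arc_path x) * (cos x / sin x) + polylog Im s (arc_path x)).
Proof.
replace (polylog Re s (arc_path x) * (cos x / sin x) + polylog Im s (arc_path x)) with
 (polylog Re s (arc_path x) * (cos x / sin x) - polylog Im s (arc_path x) * -1) by ring.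
apply (is_derive_polylog_Re s (fun t => sin t ^ 2) (fun t => sin t * cos t)).
- exact (is_derive_arc_path_Re x Hx).
- exact (is_derive_arc_path_Im x Hx).
- apply Cmod_lt_1, (arc_path_lt_1 x Hx).
Qed.

Lemma is_derive_arc_Im (x : R) (Hx : 0 < x < PI / 2) (s : nat) : is_derive (fun t => polylog Im (S s) (arc_path t)) x
   (polylog Im s (arc_path x) * (cos x / sin x) - polylog Re s (arc_path x)).
Proof.
replace (polylog Im s (arc_path x) * (cos x / sin x) - polylog Re s (arc_path x)) with
 (polylog Re s (arc_path x) * -1 + polylog Im s (arc_path x) * (cos x / sin x)) by ring.
apply (is_derive_polylog_Im s (fun t => sin t ^ 2) (fun t => sin t * cos t)).
- exact (is_derive_arc_path_Re x Hx).
- exact (is_derive_arc_path_Im x Hx).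
- apply Cmod_lt_1, (arc_path_lt_1 x Hx).
Qed.

Lemma is_derive_arc_Re_2 (x : R) (Hx : 0 < x < PI / 2) : is_derive (fun t => polylog Re 2 (arc_path t)) x
  ((ln 2 - lcos x) * (cos x / sin x) + x).
Proof.
pose proof (is_derive_arc_Re x Hx 1) as H. destruct (arc_path_log x Hx) as [H1 H2].
now rewrite H1, H2 in H.
Qed.

Lemma is_derive_arc_Im_2 (x : R) (Hx : 0 < x < PI / 2) : is_derive (fun t => polylog Im 2 (arc_path t)) x
  (x * (cos x / sin x) - (ln 2 - lcos x)).
Proof.
pose proof (is_derive_arc_Im x Hx 1) as H. destruct (arc_path_log x Hx) as [H1 H2].
now rewrite H1, H2 in H.
Qed.

Lemma is_derive_arc_Im_3 (x : R) (Hx : 0 < x < PI / 2) : is_derive (fun t => polylog Im 3 (arc_path t)) x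
  (polylog Im 2 (arc_path x) * (cos x / sin x) - polylog Re 2 (arc_path x)).
Proof. now apply is_derive_arc_Im. Qed.

(** On this path |z| = 1/(2 cos x), so the bound on [cos x] is exactly the unit disc condition. *)
Lemma line_path_lt_1 (x : R) (Hx : - (PI / 2) < x < PI / 2) (Hc : 1 / 2 < cos x) : (1 / 2) ^ 2 + (sin x / (2 * cos x)) ^ 2 < 1.
Proof.
pose proof (sin_cos_sq x).
replace ((1 / 2) ^ 2 + (sin x / (2 * cos x)) ^ 2) with ((sin x ^ 2 + cos x ^ 2) / (4 * cos x ^ 2))
  by (field; lra).
rewrite H. apply Rlt_div_l; nra.
Qed.

Lemma line_path_log (x : R) (Hx : - (PI / 2) < x < PI / 2) (Hc : 1 / 2 < cos x) : polylog Re 1 (line_path x) = lcos x /\ polylog Im 1 (line_path x) = x.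
Proof.
destruct (polylog_1 (1 / 2) (sin x / (2 * cos x)) (line_path_lt_1 x Hx Hc)) as [H1 H2].
unfold line_path. rewrite H1, H2.
pose proof (sin_cos_sq x) as E.
split.
- replace ((1 - 1 / 2) ^ 2 + (sin x / (2 * cos x)) ^ 2) with (/ ((2 * cos x) ^ 2)).
  + rewrite ln_Rinv by nra. rewrite ln_sq by lra. unfold lcos. field.
  + transitivity ((sin x ^ 2 + cos x ^ 2) / (2 * cos x) ^ 2); [rewrite E|]; field; lra.
- replace (sin x / (2 * cos x) / (1 - 1 / 2)) with (sin x / cos x) by (field; lra).
  now apply atan_sin_cos.
Qed.

Lemma is_derive_line_path_Re (x : R) (Hx : - (PI / 2) < x < PI / 2) (Hc : 1 / 2 < cos x) : is_derive (fun _ : R => 1 / 2) x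
  (1 / 2 * (sin x / cos x) - sin x / (2 * cos x) * 1).
Proof. auto_derive; [trivial|]. field. lra. Qed.

Lemma is_derive_line_path_Im (x : R) (Hx : - (PI / 2) < x < PI / 2) (Hc : 1 / 2 < cos x) : is_derive (fun t => sin t / (2 * cos t)) x
  (1 / 2 * 1 + sin x / (2 * cos x) * (sin x / cos x)).
Proof. auto_derive; [lra|]. field. lra. Qed.

Lemma is_derive_line_Re (x : R) (Hx : - (PI / 2) < x < PI / 2) (Hc : 1 / 2 < cos x) (s : nat) : is_derive (fun t => polylog Re (S s) (line_path t)) x
   (polylog Re s (line_path x) * (sin x / cos x) - polylog Im s (line_path x)).
Proof.
replace (polylog Im s (line_path x)) with (polylog Im s (line_path x) * 1) by ring.
apply (is_derive_polylog_Re s (fun _ => 1 / 2) (fun t => sin t / (2 * cos t))).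
- exact (is_derive_line_path_Re x Hx Hc).
- exact (is_derive_line_path_Im x Hx Hc).
- apply Cmod_lt_1, (line_path_lt_1 x Hx Hc).
Qed.

Lemma is_derive_line_Im (x : R) (Hx : - (PI / 2) < x < PI / 2) (Hc : 1 / 2 < cos x) (s : nat) : is_derive (fun t => polylog Im (S s) (line_path t)) x
   (polylog Re s (line_path x) + polylog Im s (line_path x) * (sin x / cos x)).
Proof.
replace (polylog Re s (line_path x)) with (polylog Re s (line_path x) * 1) by ring.
apply (is_derive_polylog_Im s (fun _ => 1 / 2) (fun t => sin t / (2 * cos t))).
- exact (is_derive_line_path_Re x Hx Hc).
- exact (is_derive_line_path_Im x Hx Hc).
- apply Cmod_lt_1, (line_path_lt_1 x Hx Hc).
Qed.

Lemma is_derive_line_Re_2 (x : R) (Hx : - (PI / 2) < x < PI / 2) (Hc : 1 / 2 < cos x) : is_derive (fun t => polylog Re 2 (line_path t)) x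
  (lcos x * (sin x / cos x) - x).
Proof.
pose proof (is_derive_line_Re x Hx Hc 1) as H. destruct (line_path_log x Hx Hc) as [H1 H2].
now rewrite H1, H2 in H.
Qed.

Lemma is_derive_line_Im_2 (x : R) (Hx : - (PI / 2) < x < PI / 2) (Hc : 1 / 2 < cos x) : is_derive (fun t => polylog Im 2 (line_path t)) x
  (lcos x + x * (sin x / cos x)).
Proof.
pose proof (is_derive_line_Im x Hx Hc 1) as H. destruct (line_path_log x Hx Hc) as [H1 H2].
now rewrite H1, H2 in H.
Qed.

Lemma is_derive_line_Im_3 (x : R) (Hx : - (PI / 2) < x < PI / 2) (Hc : 1 / 2 < cos x) : is_derive (fun t => polylog Im 3 (line_path t)) x
  (polylog Re 2 (line_path x) + polylog Im 2 (line_path x) * (sin x / cos x)).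
Proof. now apply is_derive_line_Im. Qed.

(** Here dz/z = (cot x + tan x) dx is real, so only Re Li_1 = ln(cos x) enters; [sin x < cos x]
    means |z| < 1. *)
Lemma is_derive_imag_Re_2 (x : R) : 0 < x < PI / 2 -> sin x < cos x ->
  is_derive (fun t => polylog Re 2 (imag_path t)) x
   ((lcos x - ln 2) * (cos x / sin x + sin x / cos x)).
Proof.
intros Hx Hsc. destruct (trig_pos x Hx) as [Hs Hc].
assert (Hq : 0 < sin x / cos x < 1).
{ split; [now apply Rdiv_lt_0_compat|]. apply Rlt_div_l; lra. }
assert (Hlt : 0 ^ 2 + (sin x / cos x) ^ 2 < 1) by nra.
pose proof (sin_cos_sq x) as E.
assert (H1 : polylog Re 1 (imag_path x) = lcos x - ln 2).
{ destruct (polylog_1 0 (sin x / cos x) Hlt) as [H1 _]. unfold imag_path. rewrite H1.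
  replace ((1 - 0) ^ 2 + (sin x / cos x) ^ 2) with (/ cos x ^ 2).
  - rewrite ln_Rinv by nra. rewrite ln_sq by lra. unfold lcos. rewrite ln_double by lra. field.
  - transitivity ((sin x ^ 2 + cos x ^ 2) / cos x ^ 2); [rewrite E|]; field; lra. }
rewrite <- H1.
replace (polylog Re 1 (imag_path x) * (cos x / sin x + sin x / cos x)) with
 (polylog Re 1 (imag_path x) * (cos x / sin x + sin x / cos x) - polylog Im 1 (imag_path x) * 0) by ring.
apply (is_derive_polylog_Re 1 (fun _ => 0) (fun t => sin t / cos t)).
- auto_derive; [trivial|ring].
- auto_derive; [lra|]. field. lra.
- now apply Cmod_lt_1.
Qed.

(** * The arcsine series *)

Definition cbin (n : nat) : R := 1 / 4 ^ n * Binomial.C (2 * n) n.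

Lemma cbin_0 : cbin 0 = 1.
Proof. unfold cbin, Binomial.C. simpl. field. Qed.

Lemma cbin_S (n : nat) : cbin (S n) = cbin n * ((2 * INR n + 1) / (2 * INR n + 2)).
Proof.
unfold cbin, Binomial.C.
replace (2 * S n - S n)%nat with (S n) by lia. replace (2 * n - n)%nat with n by lia.
replace (2 * S n)%nat with (S (S (2 * n))) by lia.
change (Factorial.fact (S (S (2 * n)))) with (S (S (2 * n)) * (S (2 * n) * Factorial.fact (2 * n)))%nat.
change (Factorial.fact (S n)) with (S n * Factorial.fact n)%nat.
rewrite !mult_INR, !S_INR, mult_INR.
pose proof (INR_fact_neq_0 n). pose proof (INR_fact_neq_0 (2 * n)). pose proof (pos_INR n).
assert (4 ^ n <> 0) by (apply pow_nonzero; lra).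
simpl pow. simpl (INR 2). field. repeat split; try assumption; lra.
Qed.

Lemma cbin_pos_le_1 (n : nat) : 0 < cbin n <= 1.
Proof.
induction n as [|n IH]; [rewrite cbin_0; lra|].
rewrite cbin_S. pose proof (pos_INR n).
assert (0 < (2 * INR n + 1) / (2 * INR n + 2) <= 1).
{ split; [apply Rdiv_lt_0_compat; lra|]. apply Rle_div_l; lra. }
nra.
Qed.

Lemma CV_radius_bounded_coef (a : nat -> R) (x : R) :
  (forall n, Rabs (a n) <= 1) -> Rabs x < 1 -> Rbar_lt (Rabs x) (CV_radius a).
Proof.
intros Ha Hx. apply Rbar_lt_le_trans with 1; [exact Hx|].
destruct (CV_radius_bounded a) as [H _]. apply H.
exists 1. intros n. rewrite pow1, Rmult_1_r. apply Ha.
Qed.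

(** The operator 2 y d/dy + 1 multiplies the n-th coefficient by 2n + 1, hence cancels one power of
    2n + 1 in a denominator. *)
Lemma PSeries_euler (a : nat -> R) (y : R) :
  (forall n, Rabs (a n) <= 1) -> Rabs y < 1 ->
  2 * y * PSeries (PS_derive a) y + PSeries a y
  = PSeries (fun n => (2 * INR n + 1) * a n) y.
Proof.
intros Ha Hy. pose proof (CV_radius_bounded_coef a y Ha Hy) as HR.
rewrite Rmult_assoc, <- PSeries_incr_1, <- PSeries_scal, <- PSeries_plus.
- apply PSeries_ext. intros [|n].
  + change (2 * 0 + a 0%nat = (2 * 0 + 1) * a 0%nat). ring.
  + unfold PS_plus, PS_scal, PS_incr_1, PS_derive.
    change (2 * (INR (S n) * a (S n)) + a (S n) = (2 * INR (S n) + 1) * a (S n)). ring.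
- apply ex_pseries_scal; [apply Rmult_comm|]. now apply ex_pseries_incr_1, ex_pseries_derive.
- now apply CV_radius_inside.
Qed.

Lemma odd_ge_1 (n : nat) : 1 <= 2 * INR n + 1.
Proof. pose proof (pos_INR n). lra. Qed.

Lemma cbin_div_bound (n s : nat) : Rabs (cbin n / (2 * INR n + 1) ^ s) <= 1.
Proof.
apply Rabs_div_le.
- pose proof (cbin_pos_le_1 n). rewrite Rabs_pos_eq; lra.
- apply pow_R1_Rle, odd_ge_1.
Qed.

(* Times [sin t], at [y = sin t ^ 2], it is an iterated arcsine integral. *)
Definition arcsine_series (s : nat) (y : R) : R := PSeries (fun n => cbin n / (2 * INR n + 1) ^ s) y.

(** For a series A in y = sin(t)^2, the derivative of sin(t) A is cos(t) (2 y A' + A), to which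
    [PSeries_euler] applies. *)
Lemma is_derive_sin_arcsine_series (s : nat) (t : R) : sin t ^ 2 < 1 ->
  is_derive (fun t => sin t * arcsine_series (S s) (sin t ^ 2)) t
    (cos t * arcsine_series s (sin t ^ 2)).
Proof.
intros Ht.
assert (Hy : Rabs (sin t ^ 2) < 1) by (rewrite Rabs_pos_eq; [exact Ht|apply pow2_ge_0]).
set (a := fun n => cbin n / (2 * INR n + 1) ^ S s).
assert (Ha : forall n, Rabs (a n) <= 1) by (intros n; apply cbin_div_bound).
pose proof (is_derive_PSeries a (sin t ^ 2) (CV_radius_bounded_coef a _ Ha Hy)) as HD.
replace (arcsine_series s (sin t ^ 2)) with
  (2 * (sin t ^ 2) * PSeries (PS_derive a) (sin t ^ 2) + PSeries a (sin t ^ 2)).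
- unfold arcsine_series. fold a.
  assert (Hcomp : is_derive (fun t => PSeries a (sin t ^ 2)) t
     (2 * sin t * cos t * PSeries (PS_derive a) (sin t ^ 2))).
  { apply (is_derive_comp (PSeries a) (fun t => sin t ^ 2)); [exact HD|].
    auto_derive; [trivial|ring]. }
  evar_last.
  + apply (is_derive_mult sin (fun t => PSeries a (sin t ^ 2))); [apply is_derive_sin|exact Hcomp|apply Rmult_comm].
  + change (cos t * PSeries a (sin t ^ 2) + sin t * (2 * sin t * cos t * PSeries (PS_derive a) (sin t ^ 2)) =
     cos t * (2 * sin t ^ 2 * PSeries (PS_derive a) (sin t ^ 2) + PSeries a (sin t ^ 2))). ring.
- rewrite PSeries_euler by assumption. apply PSeries_ext. intros n. unfold a.
  pose proof (odd_ge_1 n). simpl pow. field. split; [|lra]. apply pow_nonzero. lra.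
Qed.

(** The series is (1 - y)^(-1/2). The recurrence (2n+2) c_(n+1) = (2n+1) c_n becomes 2 (1 - y) A' =
    A, which makes the derivative of the product vanish. *)
Lemma cos_arcsine_series_0 (t : R) : 0 <= t < PI / 2 -> cos t * arcsine_series 0 (sin t ^ 2) = 1.
Proof.
intros Ht.
apply (eq_of_derive (fun t => cos t * arcsine_series 0 (sin t ^ 2)) (fun _ => 1) (fun _ => 0) 0 t); [lra| | |].
- intros u Hu. assert (Hc : 0 < cos u) by (apply cos_gt_0; lra).
  pose proof (sin_cos_sq u) as E.
  assert (Hy : Rabs (sin u ^ 2) < 1) by (rewrite Rabs_pos_eq; [nra|apply pow2_ge_0]).
  set (a := fun n => cbin n / (2 * INR n + 1) ^ 0).
  assert (Ha : forall n, Rabs (a n) <= 1) by (intros n; apply cbin_div_bound).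
  pose proof (CV_radius_bounded_coef a _ Ha Hy) as HR.
  pose proof (is_derive_PSeries a (sin u ^ 2) HR) as HD.
  pose proof (PSeries_euler a (sin u ^ 2) Ha Hy) as HE.
  assert (HE2 : PSeries (fun n => (2 * INR n + 1) * a n) (sin u ^ 2) =
     2 * PSeries (PS_derive a) (sin u ^ 2)).
  { rewrite <- PSeries_scal. apply PSeries_ext. intros n. unfold a, PS_scal, PS_derive.
    change (scal 2 ?v) with (2 * v). rewrite cbin_S, S_INR. pose proof (pos_INR n). simpl pow. field. lra. }
  rewrite HE2 in HE.
  assert (Hcomp : is_derive (fun t => PSeries a (sin t ^ 2)) u
     (2 * sin u * cos u * PSeries (PS_derive a) (sin u ^ 2))).
  { apply (is_derive_comp (PSeries a) (fun t => sin t ^ 2)); [exact HD|].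
    auto_derive; [trivial|ring]. }
  unfold arcsine_series. fold a.
  evar_last.
  + apply (is_derive_mult cos (fun t => PSeries a (sin t ^ 2))); [apply is_derive_cos|exact Hcomp|apply Rmult_comm].
  + change (- sin u * PSeries a (sin u ^ 2) + cos u * (2 * sin u * cos u * PSeries (PS_derive a) (sin u ^ 2)) = 0).
    replace (PSeries a (sin u ^ 2)) with (2 * PSeries (PS_derive a) (sin u ^ 2) - 2 * sin u ^ 2 * PSeries (PS_derive a) (sin u ^ 2)) by lra.
    replace (sin u ^ 2) with (1 - cos u ^ 2) at 2 by lra. ring.
- intros u Hu. apply (is_derive_const 1 u).
- rewrite sin_0, cos_0. replace (0 ^ 2) with 0 by ring. unfold arcsine_series. rewrite PSeries_0, cbin_0. simpl. field.
Qed.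

Lemma sin_arcsine_series_1 (t : R) : 0 <= t < PI / 2 -> sin t * arcsine_series 1 (sin t ^ 2) = t.
Proof.
intros Ht.
apply (eq_of_derive (fun t => sin t * arcsine_series 1 (sin t ^ 2)) (fun t => t) (fun _ => 1) 0 t); [lra| | |].
- intros u Hu. rewrite <- (cos_arcsine_series_0 u) by lra.
  assert (Hc : 0 < cos u) by (apply cos_gt_0; lra). pose proof (sin_cos_sq u).
  apply is_derive_sin_arcsine_series. nra.
- intros u Hu. apply (is_derive_id u).
- rewrite sin_0. ring.
Qed.

Definition arcsin_quot (t : R) : R := arcsine_series 2 (sin t ^ 2).

Lemma is_derive_sin_arcsin_quot (t : R) : 0 < t < PI / 2 ->
  is_derive (fun t => sin t * arcsin_quot t) t (t * (cos t / sin t)).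
Proof.
intros Ht. destruct (trig_pos t Ht) as [Hs Hc]. pose proof (sin_cos_sq t).
replace (t * (cos t / sin t)) with (cos t * arcsine_series 1 (sin t ^ 2)).
- apply is_derive_sin_arcsine_series. nra.
- transitivity (sin t * arcsine_series 1 (sin t ^ 2) * (cos t / sin t)); [field; lra|].
  rewrite sin_arcsine_series_1 by lra. reflexivity.
Qed.

(** The majorant holds up to y = 1, so convergence is uniform in t and includes t = pi/2, where the
    power series is on its circle of convergence. *)
Lemma arcsin_quot_term_bound (n : nat) (y : R) : 0 <= y <= 1 ->
  Rabs (cbin n / (2 * INR n + 1) ^ 2 * y ^ n) <= / INR (S n) ^ 2.
Proof.
intros Hy. pose proof (cbin_pos_le_1 n) as Hc. pose proof (pos_INR n) as Hn.
assert (Hyn : 0 <= y ^ n <= 1).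
{ split; [apply pow_le; lra|]. rewrite <- (pow1 n). now apply pow_incr. }
rewrite S_INR.
assert (H1 : / (2 * INR n + 1) ^ 2 <= / (INR n + 1) ^ 2).
{ apply Rinv_le_contravar; [apply pow_lt; lra|]. apply pow_incr; lra. }
assert (H2 : 0 < / (2 * INR n + 1) ^ 2) by (apply Rinv_0_lt_compat, pow_lt; lra).
rewrite Rabs_pos_eq.
- unfold Rdiv. apply Rle_trans with (1 * / (2 * INR n + 1) ^ 2 * 1); [|lra].
  apply Rmult_le_compat; try lra; [apply Rmult_le_pos; lra|]. apply Rmult_le_compat_r; lra.
- unfold Rdiv. apply Rmult_le_pos; [apply Rmult_le_pos|]; lra.
Qed.

Lemma sin_sq_bound (t : R) : 0 <= sin t ^ 2 <= 1.
Proof. pose proof (sin_cos_sq t). pose proof (pow2_ge_0 (sin t)). pose proof (pow2_ge_0 (cos t)). lra. Qed.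

Lemma arcsin_quot_continuous (t : R) : continuous arcsin_quot t.
Proof.
unfold continuous, arcsin_quot, arcsine_series, PSeries.
apply (filterlim_Series (locally t)
  (fun n u => cbin n / (2 * INR n + 1) ^ 2 * (sin u ^ 2) ^ n)
  (fun n => cbin n / (2 * INR n + 1) ^ 2 * (sin t ^ 2) ^ n) (fun n => / INR (S n) ^ 2)).
- now apply ex_series_inv_pow.
- intros n. apply arcsin_quot_term_bound, sin_sq_bound.
- apply filter_forall. intros u n. apply arcsin_quot_term_bound, sin_sq_bound.
- intros n.
  apply (ex_derive_continuous (fun u => cbin n / (2 * INR n + 1) ^ 2 * (sin u ^ 2) ^ n)).
  auto_derive. trivial.
Qed.

(** * Wallis integrals and termwise integration *)

Lemma is_RInt_sin_pow (n : nat) : is_RInt (fun t => (sin t ^ 2) ^ n) 0 (PI / 2) (PI / 2 * cbin n).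
Proof.
induction n as [|n IH].
- rewrite cbin_0. simpl pow. 
  replace (PI / 2 * 1) with (scal (PI / 2 - 0) 1) by (change (@eq R ((PI / 2 - 0) * 1) (PI / 2 * 1)); ring).
  apply (is_RInt_const 0 (PI / 2) 1).
- pose proof (pos_INR n) as Hn.
  (* The antiderivative sin^(2n+1) cos vanishes at both ends, so consecutive Wallis integrals obey
     the recurrence of [cbin_S]. *)
  assert (H : is_RInt (fun t => (2 * INR n + 1) * (sin t ^ 2) ^ n - (2 * INR n + 2) * (sin t ^ 2) ^ S n) 0 (PI / 2)
     (minus (sin (PI / 2) ^ (2 * n + 1) * cos (PI / 2)) (sin 0 ^ (2 * n + 1) * cos 0))).
  { apply (is_RInt_derive (fun t => sin t ^ (2 * n + 1) * cos t)).
    - intros t _. auto_derive; [trivial|].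
      replace (Init.Nat.pred (n + (n + 0) + 1)) with (2 * n)%nat by lia.
      replace (n + (n + 0) + 1)%nat with (S (2 * n)) by lia.
      rewrite S_INR, mult_INR. simpl (INR 2).
      rewrite <- !pow_mult. replace (2 * S n)%nat with (S (S (2 * n))) by lia.
      pose proof (sin_cos_sq t) as E.
      assert (Ec : cos t * cos t = 1 - sin t * sin t) by (simpl in E; lra).
      simpl (sin t ^ S _).
      transitivity ((2 * INR n + 1) * sin t ^ (2 * n) * (cos t * cos t) - sin t * sin t * sin t ^ (2 * n)); [simpl; ring|].
      rewrite Ec. simpl. ring.
    - intros t _. apply (ex_derive_continuous (fun t => (2 * INR n + 1) * (sin t ^ 2) ^ n - (2 * INR n + 2) * (sin t ^ 2) ^ S n)).
      auto_derive. trivial. }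
  rewrite cos_PI2, sin_0, (pow_i (2 * n + 1)) in H by lia.
  pose proof (is_RInt_scal _ _ _ (/ (2 * INR n + 2)) _
    (is_RInt_minus _ _ _ _ _ _ (is_RInt_scal _ _ _ (2 * INR n + 1) _ IH) H)) as H2.
  apply (is_RInt_ext _ (fun t => (sin t ^ 2) ^ S n)) in H2.
  + replace (PI / 2 * cbin (S n)) with (scal (/ (2 * INR n + 2)) (minus (scal (2 * INR n + 1) (PI / 2 * cbin n)) (minus (sin (PI / 2) ^ (2 * n + 1) * 0) (0 * cos 0)))); [exact H2|].
    change (/ (2 * INR n + 2) * ((2 * INR n + 1) * (PI / 2 * cbin n) - (sin (PI / 2) ^ (2 * n + 1) * 0 - 0 * cos 0)) = PI / 2 * cbin (S n)).
    rewrite cbin_S. field. lra.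
  + intros t _.
    change (/ (2 * INR n + 2) * ((2 * INR n + 1) * (sin t ^ 2) ^ n - ((2 * INR n + 1) * (sin t ^ 2) ^ n - (2 * INR n + 2) * (sin t ^ 2) ^ S n)) = (sin t ^ 2) ^ S n).
    field. lra.
Qed.

(** One [cbin n] is the coefficient of the integrand, the other its Wallis integral. A partial sum
    misses the integrand by at most a tail of [M], hence the integral by at most pi/2 times that
    tail. *)
Lemma is_series_arcsin_quot_RInt :
  is_series (fun n => PI / 2 * (cbin n / (2 * INR n + 1) ^ 2 * cbin n)) (RInt arcsin_quot 0 (PI / 2)).
Proof.
pose proof PI_RGT_0 as HPI.
set (f := fun n t => cbin n / (2 * INR n + 1) ^ 2 * (sin t ^ 2) ^ n).
set (M := fun n => / INR (S n) ^ 2).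
assert (HM : ex_series M) by (now apply ex_series_inv_pow).
assert (Hf : forall n t, Rabs (f n t) <= M n) by (intros; apply arcsin_quot_term_bound, sin_sq_bound).
assert (Hpart : forall N, is_RInt (fun t => sum_n (fun n => f n t) N) 0 (PI / 2)
   (sum_n (fun n => PI / 2 * (cbin n / (2 * INR n + 1) ^ 2 * cbin n)) N)).
{ assert (H1 : forall n, is_RInt (f n) 0 (PI / 2) (PI / 2 * (cbin n / (2 * INR n + 1) ^ 2 * cbin n))).
  { intros n. replace (PI / 2 * (cbin n / (2 * INR n + 1) ^ 2 * cbin n)) with
      (scal (cbin n / (2 * INR n + 1) ^ 2) (PI / 2 * cbin n)).
    - apply (is_RInt_scal (fun t => (sin t ^ 2) ^ n)), is_RInt_sin_pow.
    - change (cbin n / (2 * INR n + 1) ^ 2 * (PI / 2 * cbin n) = PI / 2 * (cbin n / (2 * INR n + 1) ^ 2 * cbin n)). ring. }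
  induction N as [|N IH].
  - rewrite sum_O. apply (is_RInt_ext (f 0%nat)); [intros; now rewrite sum_O|apply H1].
  - rewrite sum_Sn. apply (is_RInt_ext (fun t => plus (sum_n (fun n => f n t) N) (f (S N) t))).
    + intros; now rewrite sum_Sn.
    + now apply (is_RInt_plus (V := R_NormedModule)). }
assert (Hg : is_RInt arcsin_quot 0 (PI / 2) (RInt arcsin_quot 0 (PI / 2))).
{ apply (RInt_correct (V := R_CompleteNormedModule)), (ex_RInt_continuous (V := R_CompleteNormedModule)).
  intros; apply arcsin_quot_continuous. }
assert (Hlim : is_lim_seq (fun N => Series (fun k => M (S N + k)%nat)) 0).
{ apply (is_lim_seq_ext (fun N => Series M - sum_n M N)).
  - intros N. rewrite (Series_incr_n M (S N)); [|lia|exact HM]. rewrite sum_n_Reals. simpl Init.Nat.pred. ring.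
  - replace (Finite 0) with (Finite (Series M - Series M)) by (f_equal; ring).
    apply is_lim_seq_minus'; [apply is_lim_seq_const|]. exact (Series_correct M HM). }
unfold is_series.
apply (is_lim_seq_ext (fun N => RInt arcsin_quot 0 (PI / 2) - (RInt arcsin_quot 0 (PI / 2) -
   sum_n (fun n => PI / 2 * (cbin n / (2 * INR n + 1) ^ 2 * cbin n)) N)) _ (RInt arcsin_quot 0 (PI / 2))).
{ intros N. match goal with |- ?a - (?a - ?b) = ?c => change c with b; generalize a b end. intros; ring. }
replace (Finite (RInt arcsin_quot 0 (PI / 2))) with (Finite (RInt arcsin_quot 0 (PI / 2) - 0)) by (f_equal; ring).
apply is_lim_seq_minus'; [apply is_lim_seq_const|].
apply is_lim_seq_abs_0.
apply (is_lim_seq_le_le (fun _ => 0) _ (fun N => PI / 2 * Series (fun k => M (S N + k)%nat))).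
2: apply is_lim_seq_const.
2: { replace (Finite 0) with (Finite (PI / 2 * 0)) by (f_equal; ring). now apply (is_lim_seq_scal_l _ _ 0). }
intros N. split; [apply Rabs_pos|].
pose proof (is_RInt_minus _ _ _ _ _ _ Hg (Hpart N)) as HI.
replace (PI / 2 * Series (fun k => M (S N + k)%nat)) with
  ((PI / 2 - 0) * Series (fun k => M (S N + k)%nat)) by ring.
apply (norm_RInt_le_const (V := R_NormedModule) (fun t => minus (arcsin_quot t) (sum_n (fun n => f n t) N)) 0 (PI / 2)); [lra| |exact HI].
intros t _.
change (Rabs (arcsin_quot t - sum_n (fun n => f n t) N) <= Series (fun k => M (S N + k)%nat)).
unfold arcsin_quot, arcsine_series, PSeries. change (fun k => cbin k / (2 * INR k + 1) ^ 2 * (sin t ^ 2) ^ k) with (fun k => f k t).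
rewrite (Series_incr_n (fun k => f k t) (S N)); [|lia|now apply (ex_series_dominated _ M)].
rewrite sum_n_Reals. simpl Init.Nat.pred.
match goal with |- Rabs (?a + ?b - ?a) <= _ => replace (a + b - a) with b by ring end.
apply Series_dominated; [now apply ex_series_incr_n|]. intros k. apply Hf.
Qed.

(** * Duplication formula and limits at 0 *)

Lemma is_series_pairs (a : nat -> R) (l : R) :
  is_series a l -> is_series (fun k => a (2 * k)%nat + a (2 * k + 1)%nat) l.
Proof.
intros H.
apply (is_lim_seq_ext (fun n => sum_n a (2 * n + 1)) _ l).
- induction n as [|n IH].
  + simpl. rewrite sum_Sn, !sum_O. reflexivity.
  + rewrite sum_Sn, <- IH. replace (2 * S n + 1)%nat with (S (S (2 * n + 1))) by lia.
    rewrite !sum_Sn. replace (2 * S n)%nat with (S (2 * n + 1)) by lia.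
    apply eq_sym, (plus_assoc (G := R_AbelianGroup)).
- apply (is_lim_seq_subseq (sum_n a) l (fun n => (2 * n + 1)%nat)); [|exact H].
  apply eventually_subseq. intros n. lia.
Qed.

Lemma ex_series_polylog (p : C -> R) (s : nat) (z : C) :
  real_functional p -> (2 <= s)%nat -> Cmod z <= 1 ->
  ex_series (fun m => p (z ^ S m)%C / INR (S m) ^ s).
Proof.
intros Hp Hs Hz.
apply (ex_series_dominated _ (fun m => / INR (S m) ^ s * Cmod z)).
- now apply ex_series_scal_r, ex_series_inv_pow.
- intros m. now apply polylog_term_bound.
Qed.

(** Odd exponents cancel and even ones double. As the sum is shifted to start at 0, the exponents
    2k+1 and 2k+2 sit at positions 2k and 2k+1. *)
Lemma polylog_duplication (p : C -> R) (s : nat) (z : C) :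
  real_functional p -> (2 <= s)%nat -> Cmod z <= 1 ->
  polylog p s z + polylog p s (- z) = 2 / 2 ^ s * polylog p s (z * z).
Proof.
intros Hp Hs Hz. pose proof Hp as [Hadd [Hscal _]].
assert (Hz' : Cmod (- z) <= 1) by (now rewrite Cmod_opp).
unfold polylog. rewrite <- Series_plus by (now apply ex_series_polylog).
rewrite <- Series_scal_l.
assert (Hex : ex_series (fun m => p (z ^ S m)%C / INR (S m) ^ s + p ((- z) ^ S m)%C / INR (S m) ^ s)).
{ apply (ex_series_plus (V := R_NormedModule)); now apply ex_series_polylog. }
rewrite <- (is_series_unique _ _ (is_series_pairs _ _ (Series_correct _ Hex))).
apply Series_ext. intros m.
assert (Hodd : ((- z) ^ S (2 * m) = RtoC (-1) * z ^ S (2 * m))%C).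
{ replace (- z)%C with (RtoC (-1) * z)%C by (destruct z; unfold Cmult, Copp, RtoC; simpl; f_equal; ring).
  rewrite Cpow_mult_l, <- RtoC_pow. rewrite pow_1_odd. reflexivity. }
assert (Hev : ((- z) ^ S (2 * m + 1) = z ^ S (2 * m + 1))%C).
{ replace (- z)%C with (RtoC (-1) * z)%C by (destruct z; unfold Cmult, Copp, RtoC; simpl; f_equal; ring).
  rewrite Cpow_mult_l, <- RtoC_pow. replace (S (2 * m + 1)) with (2 * S m)%nat at 1 by lia.
  rewrite pow_1_even. ring. }
rewrite Hodd, Hev, Hscal.
replace (S (2 * m + 1)) with (2 * S m)%nat by lia.
replace ((z * z) ^ S m)%C with (z ^ (2 * S m))%C
  by (rewrite Cpow_mult_r; f_equal; simpl; ring).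
rewrite mult_INR, Rpow_mult_distr. change (INR 2) with 2.
pose proof (pow_INR_S_ge_1 m s) as H1. pose proof (pow_INR_S_ge_1 (2 * m) s) as H2.
assert (0 < 2 ^ s) by (apply pow_lt; lra).
field. repeat split; lra.
Qed.

(** Duplication at 1 gives Li2(-1) = - Li2(1)/2. At i, whose square is -1, the values at i and -i
    have equal real parts, so Re Li2(i) = Li2(-1)/4. *)
Lemma polylog_Re_2_Ci : polylog Re 2 (0, 1) = - polylog Re 2 (1, 0) / 8.
Proof.
assert (H1 : Cmod (1, 0) <= 1) by (apply Cmod_le_1; lra).
assert (Hi : Cmod (0, 1) <= 1) by (apply Cmod_le_1; lra).
pose proof (polylog_duplication Re 2 (1, 0) real_functional_Re (le_n _) H1) as E1.
pose proof (polylog_duplication Re 2 (0, 1) real_functional_Re (le_n _) Hi) as Ei.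
replace ((1, 0) * (1, 0))%C with ((1, 0) : C) in E1
  by (unfold Cmult; simpl; f_equal; ring).
replace ((0, 1) * (0, 1))%C with (- (1, 0))%C in Ei
  by (unfold Cmult, Copp; simpl; f_equal; ring).
assert (Hconj : polylog Re 2 (- (0, 1)) = polylog Re 2 (0, 1)).
{ unfold polylog. apply Series_ext. intros m. f_equal.
  replace (- (0, 1))%C with (Cconj (0, 1)) by (unfold Cconj, Copp; simpl; f_equal; ring).
  rewrite <- Cpow_conj. reflexivity. }
rewrite Hconj in Ei. simpl pow in *. lra.
Qed.

Lemma polylog_Im_real (s : nat) (x : R) : polylog Im s (x, 0) = 0.
Proof.
unfold polylog. transitivity (0 * Series (fun _ : nat => 0)); [|ring].
rewrite <- Series_scal_l. apply Series_ext. intros m.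
change ((x, 0) ^ S m)%C with (RtoC x ^ S m)%C. rewrite <- RtoC_pow. unfold Im, RtoC. simpl snd.
unfold Rdiv. ring.
Qed.

(** * One-sided limits at 0 *)

Definition lim0 (f : R -> R) (l : R) := filterlim f (at_right 0) (locally l).

Lemma lim0_plus (f g : R -> R) (a b : R) : lim0 f a -> lim0 g b -> lim0 (fun x => f x + g x) (a + b).
Proof.
intros Hf Hg. apply (filterlim_comp_2 (G := locally a) (H := locally b) f g Rplus Hf Hg).
apply (@filterlim_plus R_AbsRing R_NormedModule a b).
Qed.

Lemma lim0_mult (f g : R -> R) (a b : R) : lim0 f a -> lim0 g b -> lim0 (fun x => f x * g x) (a * b).
Proof.
intros Hf Hg. apply (filterlim_comp_2 (G := locally a) (H := locally b) f g Rmult Hf Hg).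
apply (@filterlim_mult R_AbsRing a b).
Qed.

Lemma lim0_const (a : R) : lim0 (fun _ => a) a.
Proof. apply filterlim_const. Qed.

Lemma lim0_scal (k : R) (f : R -> R) (a : R) : lim0 f a -> lim0 (fun x => k * f x) (k * a).
Proof. intros Hf. apply (lim0_mult (fun _ => k) f); [apply lim0_const|exact Hf]. Qed.

Lemma lim0_minus (f g : R -> R) (a b : R) : lim0 f a -> lim0 g b -> lim0 (fun x => f x - g x) (a - b).
Proof.
intros Hf Hg. apply (lim0_plus f (fun x => - g x) a (- b) Hf).
apply (filterlim_comp _ _ _ g Ropp (at_right 0) (locally b)); [exact Hg|].
apply (@filterlim_opp R_AbsRing R_NormedModule b).
Qed.

Lemma lim0_continuous (f : R -> R) : continuous f 0 -> lim0 f (f 0).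
Proof. intros Hf. eapply filterlim_filter_le_1; [apply filter_le_within|exact Hf]. Qed.

Lemma lim0_unique (f : R -> R) (a b : R) : lim0 f a -> lim0 f b -> a = b.
Proof.
intros Ha Hb. apply (filterlim_locally_unique (F := at_right 0) f a b Ha Hb).
Qed.

Lemma at_right_0_lt (b : R) : 0 < b -> at_right 0 (fun x => 0 < x < b).
Proof.
intros Hb. exists (mkposreal b Hb). intros y Hy Hy0. split; [exact Hy0|].
change (Rabs (y - 0) < b) in Hy. apply Rabs_def2 in Hy. lra.
Qed.

Lemma lim0_ext (b : R) (f g : R -> R) (l : R) : 0 < b ->
  (forall x, 0 < x < b -> f x = g x) -> lim0 f l -> lim0 g l.
Proof.
intros Hb H Hf. eapply filterlim_ext_loc; [|exact Hf].
eapply filter_imp; [|exact (at_right_0_lt b Hb)]. exact H.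
Qed.

Lemma lim0_squeeze (b : R) (f g : R -> R) : 0 < b ->
  (forall x, 0 < x < b -> Rabs (f x) <= g x) -> lim0 g 0 -> lim0 f 0.
Proof.
intros Hb H Hg. apply filterlim_locally. intros eps.
generalize (filter_and _ _ (at_right_0_lt b Hb) (proj1 (filterlim_locally _ _) Hg eps)).
apply filter_imp. intros x [Hx Hgx].
change (Rabs (g x - 0) < eps) in Hgx. change (Rabs (f x - 0) < eps).
rewrite Rminus_0_r in *. specialize (H x Hx). apply Rabs_def2 in Hgx. lra.
Qed.

Lemma ln_le_minus_1 (y : R) : 0 < y -> ln y <= y - 1.
Proof. intros Hy. pose proof (exp_ineq1_le (ln y)) as H. rewrite exp_ln in H by exact Hy. lra. Qed.

(** With r the fourth root of u, |ln u| = 4 |ln r| <= 4/r, whence the bound r^4 (16/r^2). The same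
    argument with the square root would give boundedness only. *)
Lemma mul_ln_sq_bound (u : R) : 0 < u < 1 -> u * ln u ^ 2 <= 16 * sqrt u.
Proof.
intros Hu.
set (r := sqrt (sqrt u)).
assert (H0 : 0 < sqrt u) by (apply sqrt_lt_R0; lra).
assert (Hr : 0 < r) by (apply sqrt_lt_R0; exact H0).
assert (Hr2 : r ^ 2 = sqrt u) by (apply pow2_sqrt; lra).
assert (Hr4 : u = (r ^ 2) ^ 2) by (rewrite Hr2; symmetry; apply pow2_sqrt; lra).
assert (Hr1 : r < 1).
{ assert (r ^ 2 < 1); [|nra]. rewrite Hr2, <- sqrt_1. apply sqrt_lt_1; lra. }
assert (Hl : ln u = 4 * ln r) by (rewrite Hr4, !ln_sq; [ring|exact Hr|apply pow_lt, Hr]).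
assert (Hb : - ln r <= / r) .
{ rewrite <- ln_Rinv by exact Hr. pose proof (ln_le_minus_1 (/ r) (Rinv_0_lt_compat _ Hr)). lra. }
assert (Hn : ln r < 0) by (rewrite <- ln_1; apply ln_increasing; lra).
assert (Hb2 : - (r * ln r) <= 1).
{ apply Rmult_le_reg_l with (/ r); [now apply Rinv_0_lt_compat|].
  replace (/ r * - (r * ln r)) with (- ln r) by (field; lra). lra. }
rewrite Hl. rewrite <- Hr2. rewrite Hr4 at 1.
replace ((r ^ 2) ^ 2 * (4 * ln r) ^ 2) with (16 * r ^ 2 * (- (r * ln r)) ^ 2) by ring.
assert (0 <= - (r * ln r)) by nra.
assert ((- (r * ln r)) ^ 2 <= 1) by nra.
assert (0 < r ^ 2) by (apply pow_lt, Hr). nra.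
Qed.

(* Vanishes at 0 and dominates [x], [x * |lsin x|] and [x * lsin x ^ 2] near 0. *)
Definition sin_gauge (x : R) : R := 2 * sin x + 2 * sin x * lsin x ^ 2.

Lemma lim0_sin_gauge : lim0 sin_gauge 0.
Proof.
apply (lim0_squeeze (1 / 2) _ (fun x => 2 * x + 16 * sqrt (2 * x))); [lra| |].
- intros x Hx. pose proof PI2_1.
  assert (Hs0 : 0 < sin x) by (apply sin_gt_0; lra).
  assert (Hsx : sin x < x) by (apply sin_lt_x; lra).
  unfold sin_gauge, lsin.
  pose proof (mul_ln_sq_bound (2 * sin x) ltac:(lra)) as H1.
  assert (H2 : sqrt (2 * sin x) <= sqrt (2 * x)) by (apply sqrt_le_1_alt; lra).
  pose proof (pow2_ge_0 (ln (2 * sin x))).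
  rewrite Rabs_pos_eq; [lra|]. nra.
- replace 0 with (2 * 0 + 16 * sqrt (2 * 0)) at 1 by (rewrite Rmult_0_r, sqrt_0; ring).
  apply (lim0_continuous (fun x => 2 * x + 16 * sqrt (2 * x))).
  apply (continuous_plus (fun x => 2 * x) (fun x => 16 * sqrt (2 * x))).
  + apply (ex_derive_continuous (fun x => 2 * x)). auto_derive. trivial.
  + apply (continuous_mult (fun _ => 16) (fun x => sqrt (2 * x))); [apply continuous_const|].
    apply (continuous_comp (fun x => 2 * x) sqrt).
    * apply (ex_derive_continuous (fun x => 2 * x)). auto_derive. trivial.
    * apply continuous_sqrt.
Qed.

Lemma cos_gt_half (x : R) : 0 <= x <= PI / 4 -> 1 / 2 < cos x.
Proof.
intros Hx. pose proof PI_RGT_0.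
assert (H1 : cos (PI / 4) <= cos x).
{ destruct (Rle_lt_or_eq_dec x (PI / 4) (proj2 Hx)) as [H1| ->]; [|lra].
  left. apply cos_decreasing_1; lra. }
assert (H2 : cos (PI / 4) = sin (PI / 4)) by (rewrite sin_PI4, cos_PI4; reflexivity).
pose proof (sin_cos_sq (PI / 4)) as H3. rewrite <- H2 in H3.
assert (0 < cos (PI / 4)) by (apply cos_gt_0; lra). nra.
Qed.

Lemma x_le_2_sin (x : R) : 0 <= x <= PI / 4 -> x <= 2 * sin x.
Proof.
intros Hx.
destruct (MVT_gen (fun t => 2 * sin t - t) 0 x (fun t => 2 * cos t - 1)) as [c [Hc E]].
- intros t _. auto_derive; [trivial|ring].
- intros t _. apply derivable_continuous_pt, ex_derive_Reals_0. auto_derive. trivial.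
- rewrite Rmin_left, Rmax_right in Hc by lra. rewrite sin_0 in E.
  pose proof (cos_gt_half c ltac:(lra)). nra.
Qed.

Lemma sin_gauge_bounds (x : R) : 0 < x <= PI / 4 ->
  2 * sin x <= sin_gauge x /\ 2 * sin x * Rabs (lsin x) <= sin_gauge x /\
  2 * sin x * lsin x ^ 2 <= sin_gauge x.
Proof.
intros Hx. pose proof PI_RGT_0.
assert (Hs : 0 < sin x) by (apply sin_gt_0; lra).
unfold sin_gauge. pose proof (pow2_ge_0 (lsin x)).
assert (Rabs (lsin x) <= 1 + lsin x ^ 2).
{ apply Rabs_le. nra. }
repeat split; nra.
Qed.

(** * Antiderivatives *)

Definition arc_Re2 (x : R) : R := polylog Re 2 (arc_path x).
Definition arc_Im2 (x : R) : R := polylog Im 2 (arc_path x).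
Definition arc_Im3 (x : R) : R := polylog Im 3 (arc_path x).
(** Defined by reflection, so that no polylogarithm has to be differentiated along the second
    path. *)
Definition coarc_Re2 (x : R) : R := arc_Re2 (PI / 2 - x).
Definition coarc_Im2 (x : R) : R := arc_Im2 (PI / 2 - x).
Definition coarc_Im3 (x : R) : R := arc_Im3 (PI / 2 - x).
Definition line_Re2 (x : R) : R := polylog Re 2 (line_path x).
Definition line_Im2 (x : R) : R := polylog Im 2 (line_path x).
Definition line_Im3 (x : R) : R := polylog Im 3 (line_path x).
Definition imag_Re2 (x : R) : R := polylog Re 2 (imag_path x).

(** For expressions in functions known only through [is_derive] hypotheses: each [Derive] left by
    [auto_derive] is rewritten with the matching hypothesis. *)
Ltac derive_with :=
  auto_derive;
  [ repeat split; first [exact I | eexists; eassumption | idtac]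
  | repeat match goal with
      | H : is_derive ?f ?x ?l |- context [Derive _ ?x] => 
          change (Derive (fun y => f y) x) with (Derive f x);
          rewrite (is_derive_unique f x l H); clear H
    end ].

Lemma is_derive_reflect (f : R -> R) (x l : R) :
  is_derive f (PI / 2 - x) l -> is_derive (fun t => f (PI / 2 - t)) x (- l).
Proof.
intros H. replace (- l) with (-1 * l) by ring.
apply (is_derive_comp f (fun t => PI / 2 - t)); [exact H|].
auto_derive; [trivial|ring].
Qed.

Lemma lsin_reflect (x : R) : lsin (PI / 2 - x) = lcos x.
Proof. unfold lsin, lcos. now rewrite sin_shift. Qed.

Lemma lcos_reflect (x : R) : lcos (PI / 2 - x) = lsin x.
Proof. unfold lsin, lcos. now rewrite cos_shift. Qed.

Lemma is_derive_coarc_Re2 (x : R) : 0 < x < PI / 2 ->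
  is_derive coarc_Re2 x ((lsin x - ln 2) * (sin x / cos x) - (PI / 2 - x)).
Proof.
intros Hx. pose proof (is_derive_arc_Re_2 (PI / 2 - x) ltac:(lra)) as H.
rewrite lcos_reflect, cos_shift, sin_shift in H. apply is_derive_reflect in H.
evar_last; [exact H|]. ring.
Qed.

Lemma is_derive_coarc_Im2 (x : R) : 0 < x < PI / 2 ->
  is_derive coarc_Im2 x (ln 2 - lsin x - (PI / 2 - x) * (sin x / cos x)).
Proof.
intros Hx. pose proof (is_derive_arc_Im_2 (PI / 2 - x) ltac:(lra)) as H.
rewrite lcos_reflect, cos_shift, sin_shift in H. apply is_derive_reflect in H.
evar_last; [exact H|]. ring.
Qed.

Lemma is_derive_coarc_Im3 (x : R) : 0 < x < PI / 2 ->
  is_derive coarc_Im3 x (coarc_Re2 x - coarc_Im2 x * (sin x / cos x)).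
Proof.
intros Hx. pose proof (is_derive_arc_Im_3 (PI / 2 - x) ltac:(lra)) as H.
rewrite cos_shift, sin_shift in H. apply is_derive_reflect in H.
evar_last; [exact H|]. unfold coarc_Re2, coarc_Im2, arc_Re2, arc_Im2. ring.
Qed.

(* The next three functions are imaginary trilogarithms along a path, corrected by products of lower weight
   so that their derivatives contain no dilogarithm. *)
Definition arc_word (x : R) : R :=
  arc_Im3 x - lsin x * arc_Im2 x + x * arc_Re2 x - ln 2 * x * lsin x.

Definition coarc_word (x : R) : R :=
  coarc_Im3 x - lcos x * coarc_Im2 x - x * coarc_Re2 x + ln 2 * x * lcos x.

Definition line_word (x : R) : R :=
  line_Im3 x + lcos x * line_Im2 x - x * line_Re2 x - x ^ 3 / 3.

(** In the derivative of [arc_Im3] the dilogarithms have coefficients cot x and -1; subtracting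
    [lsin x] and adding [x] times them, antiderivatives of these up to sign, removes both. The last
    term of [arc_word] removes the ln 2 in - ln(cos x) = ln 2 - [lcos x]. *)
Lemma is_derive_arc_word (x : R) : 0 < x < PI / 2 ->
  is_derive arc_word x
    (- lsin x * lcos x - x * (cos x / sin x) * (lsin x + lcos x) + x ^ 2).
Proof.
intros Hx. destruct (trig_pos x Hx) as [Hs Hc].
pose proof (is_derive_arc_Re_2 x Hx : is_derive arc_Re2 x _) as H1.
pose proof (is_derive_arc_Im_2 x Hx : is_derive arc_Im2 x _) as H2.
pose proof (is_derive_arc_Im_3 x Hx : is_derive arc_Im3 x _) as H3.
fold (arc_Im2 x) (arc_Re2 x) in H3.
pose proof (is_derive_lsin x Hs) as H4.
(* With the quotient turned into a variable, the final identity is polynomial. *)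
unfold arc_word. generalize dependent (cos x / sin x). intros k H1 H2 H3 H4.
derive_with. ring.
Qed.

Lemma is_derive_coarc_word (x : R) : 0 < x < PI / 2 ->
  is_derive coarc_word x
    (lsin x * lcos x - x * (sin x / cos x) * (lsin x + lcos x)
     + PI / 2 * lcos x * (sin x / cos x) - x ^ 2 + PI / 2 * x).
Proof.
intros Hx. destruct (trig_pos x Hx) as [Hs Hc].
pose proof (is_derive_coarc_Re2 x Hx) as H1.
pose proof (is_derive_coarc_Im2 x Hx) as H2.
pose proof (is_derive_coarc_Im3 x Hx) as H3.
pose proof (is_derive_lcos x Hc) as H4.
unfold coarc_word. generalize dependent (sin x / cos x). intros k H1 H2 H3 H4.
derive_with. field.
Qed.

(** The domain contains 0, where this path is regular, so the value at 0 can be used directly. *)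
Lemma is_derive_line_word (x : R) : - (PI / 2) < x < PI / 2 -> 1 / 2 < cos x ->
  is_derive line_word x (lcos x ^ 2).
Proof.
intros Hx Hc.
pose proof (is_derive_line_Re_2 x Hx Hc : is_derive line_Re2 x _) as H1.
pose proof (is_derive_line_Im_2 x Hx Hc : is_derive line_Im2 x _) as H2.
pose proof (is_derive_line_Im_3 x Hx Hc : is_derive line_Im3 x _) as H3.
fold (line_Im2 x) (line_Re2 x) in H3.
pose proof (is_derive_lcos x ltac:(lra)) as H4.
unfold line_word. generalize dependent (sin x / cos x). intros k H1 H2 H3 H4.
derive_with. field.
Qed.

(** An antiderivative of ln(tan x)^2. The two words have the same trilogarithm at pi/4 and enter
    through their difference, so the increment from 0 to pi/4 is elementary, namely pi^3/16. *)
Definition lntan_sq_prim (x : R) : R :=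
  2 * (arc_word x - coarc_word x) + x * (lsin x + lcos x) ^ 2
  - PI / 2 * lcos x ^ 2 - 4 * x ^ 3 / 3 + PI / 2 * x ^ 2.

Lemma is_derive_lntan_sq_prim (x : R) : 0 < x < PI / 2 ->
  is_derive lntan_sq_prim x ((lsin x - lcos x) ^ 2).
Proof.
intros Hx. destruct (trig_pos x Hx) as [Hs Hc].
pose proof (is_derive_arc_word x Hx) as H1.
pose proof (is_derive_coarc_word x Hx) as H2.
pose proof (is_derive_lsin x Hs) as H3.
pose proof (is_derive_lcos x Hc) as H4.
unfold lntan_sq_prim. revert H1 H2 H3 H4. 
generalize (sin x / cos x) (cos x / sin x). intros k t H1 H2 H3 H4.
derive_with. field.
Qed.

(** Based at pi/4 rather than at the singular point 0, so that the integral is proper for x in (0,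
    pi). *)
Definition lsin_sq_prim (x : R) : R := RInt (fun t => lsin t ^ 2) (PI / 4) x.

(** The range extends past pi/2 because reflection and duplication both differentiate at pi/2. *)
Lemma is_derive_lsin_sq_prim (x : R) : 0 < x < PI -> is_derive lsin_sq_prim x (lsin x ^ 2).
Proof.
intros Hx.
assert (Hcont : forall t, 0 < t < PI -> continuous (fun t => lsin t ^ 2) t).
{ intros t Ht. pose proof (sin_gt_0 t (proj1 Ht) (proj2 Ht)) as Hs.
  apply (ex_derive_continuous (fun t => lsin t ^ 2)).
  pose proof (is_derive_lsin t Hs) as H. auto_derive. eexists; eassumption. }
apply (is_derive_RInt (fun t => lsin t ^ 2) lsin_sq_prim (PI / 4) x); [|now apply Hcont].
assert (He : 0 < Rmin x (PI - x)) by (apply Rmin_glb_lt; lra).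
exists (mkposreal _ He). intros y Hy. change (Rabs (y - x) < Rmin x (PI - x)) in Hy.
pose proof (Rmin_l x (PI - x)). pose proof (Rmin_r x (PI - x)). apply Rabs_def2 in Hy.
apply (RInt_correct (V := R_CompleteNormedModule)), (ex_RInt_continuous (V := R_CompleteNormedModule)).
intros z Hz. apply Hcont. pose proof PI_RGT_0.
assert (0 < Rmin (PI / 4) y) by (apply Rmin_glb_lt; lra).
assert (Rmax (PI / 4) y < PI) by (apply Rmax_lub_lt; lra). lra.
Qed.

(* At [PI / 4], where [lsin = lcos], this is [- 1 / 2] times the integral of [arcsin_quot] over [0, PI / 2]. *)
Definition target_prim (x : R) : R :=
  ((lsin x - lcos x) * (sin (2 * x) * arcsin_quot (2 * x)) - RInt arcsin_quot 0 (2 * x)) / 2.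

Lemma is_derive_RInt_arcsin_quot (y : R) : is_derive (fun y => RInt arcsin_quot 0 y) y (arcsin_quot y).
Proof.
apply (is_derive_RInt arcsin_quot _ 0 y); [|apply arcsin_quot_continuous].
apply filter_forall. intros z.
apply (RInt_correct (V := R_CompleteNormedModule)), (ex_RInt_continuous (V := R_CompleteNormedModule)).
intros; apply arcsin_quot_continuous.
Qed.

Lemma is_derive_dilate2 (f : R -> R) (x l : R) :
  is_derive f (2 * x) l -> is_derive (fun t => f (2 * t)) x (2 * l).
Proof.
intros H. apply (is_derive_comp f (fun t => 2 * t)); [exact H|].
auto_derive; [trivial|ring].
Qed.

(** The derivative of [lsin x - lcos x], that is of ln(tan x), is 2/sin(2x), so the terms in
    [arcsin_quot (2 * x)] cancel. What remains is 2x cot(2x) ln(tan x), and 2 cot(2x) = cot x - tan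
    x. *)
Lemma is_derive_target_prim (x : R) : 0 < x < PI / 4 ->
  is_derive target_prim x (x * (cos x / sin x - sin x / cos x) * (lsin x - lcos x)).
Proof.
intros Hx. destruct (trig_pos x ltac:(lra)) as [Hs Hc].
destruct (trig_pos (2 * x) ltac:(lra)) as [Hs2 Hc2].
set (f := fun t => RInt arcsin_quot 0 (2 * t) : R).
set (g := fun t => sin (2 * t) * arcsin_quot (2 * t)).
pose proof (is_derive_dilate2 _ _ _ (is_derive_RInt_arcsin_quot (2 * x)) : is_derive f x _) as H1.
pose proof (is_derive_dilate2 _ _ _ (is_derive_sin_arcsin_quot (2 * x) ltac:(lra)) : is_derive g x _) as H2.
pose proof (is_derive_lsin x Hs) as H3.
pose proof (is_derive_lcos x Hc) as H4.
apply (is_derive_ext (fun x => ((lsin x - lcos x) * g x - f x) / 2)); [reflexivity|].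
derive_with. unfold g. rewrite sin_2a, cos_2a. pose proof (sin_cos_sq x) as E.
transitivity (((cos x / sin x + sin x / cos x) * (2 * sin x * cos x * arcsin_quot (2 * x)) - 2 * arcsin_quot (2 * x)) / 2
  + x * (cos x / sin x - sin x / cos x) * (lsin x - lcos x)).
- field. lra.
- replace (cos x / sin x + sin x / cos x) with (/ (sin x * cos x)); [field; lra|].
  transitivity ((sin x ^ 2 + cos x ^ 2) / (sin x * cos x)); [rewrite E|]; field; lra.
Qed.

(** Limits replace values at both ends: the functions concerned are singular at 0, and in Landen's
    formula the path leaves the open disc at [b]. *)
Lemma zero_derive_endpoints (f : R -> R) (b l m : R) : 0 < b ->
  (forall x, 0 < x < b -> is_derive f x 0) ->
  lim0 f l -> filterlim f (at_left b) (locally m) -> l = m.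
Proof.
intros Hb Hd Hl Hm.
assert (Hconst : forall x y, 0 < x < b -> x < y < b -> f x = f y).
{ intros x y Hx Hy. apply (eq_is_derive f x y); [|lra]. intros t Ht. apply Hd. lra. }
assert (Hmid : forall x, 0 < x < b -> f x = f (b / 2)).
{ intros x Hx. destruct (Rtotal_order x (b / 2)) as [H|[->|H]]; [|reflexivity|].
  - apply Hconst; lra.
  - symmetry. apply Hconst; lra. }
transitivity (f (b / 2)).
- apply (lim0_unique f _ _ Hl). apply (lim0_ext b (fun _ => f (b / 2))); [exact Hb| |apply lim0_const].
  intros x Hx. symmetry. now apply Hmid.
- apply (filterlim_locally_unique (F := at_left b) f); [|exact Hm].
  eapply filterlim_ext_loc; [|apply filterlim_const].
  exists (mkposreal b Hb). intros y Hy Hyb. change (Rabs (y - b) < b) in Hy. apply Rabs_def2 in Hy.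
  symmetry. apply Hmid. lra.
Qed.

Lemma zero_derive_continuous (f : R -> R) (b l : R) : 0 < b ->
  (forall x, 0 < x < b -> is_derive f x 0) -> lim0 f l -> continuous f b -> f b = l.
Proof.
intros Hb Hd Hl Hc. symmetry. apply (zero_derive_endpoints f b); try assumption.
eapply filterlim_filter_le_1; [apply filter_le_within|exact Hc].
Qed.

Lemma is_derive_continuous (f : R -> R) (x l : R) : is_derive f x l -> continuous f x.
Proof. intros H. apply (ex_derive_continuous f). now exists l. Qed.

(** * Limits of the words and antiderivatives at 0 *)

Lemma Cmod_arc_path (x : R) : 0 < sin x -> Cmod (arc_path x) = sin x.
Proof.
intros Hs. change (sqrt ((sin x ^ 2) ^ 2 + (sin x * cos x) ^ 2) = sin x).
replace ((sin x ^ 2) ^ 2 + (sin x * cos x) ^ 2) with (sin x ^ 2 * (sin x ^ 2 + cos x ^ 2)) by ring.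
rewrite sin_cos_sq, Rmult_1_r. apply sqrt_pow2. lra.
Qed.

Lemma arc_polylog_bound (p : C -> R) (s : nat) (x : R) :
  real_functional p -> (2 <= s)%nat -> 0 < x < PI / 2 ->
  Rabs (polylog p s (arc_path x)) <= Series (fun m => / INR (S m) ^ s) * sin x.
Proof.
intros Hp Hs Hx. destruct (trig_pos x Hx) as [H1 H2].
pose proof (SIN_bound x) as Hb.
rewrite <- (Cmod_arc_path x H1). apply polylog_bound; [assumption..|].
rewrite Cmod_arc_path; lra.
Qed.

Lemma lim0_id : lim0 (fun x => x) 0.
Proof. apply (lim0_continuous (fun x => x)), continuous_id. Qed.

Lemma lim0_lcos : lim0 lcos (ln 2).
Proof.
replace (ln 2) with (lcos 0) by (unfold lcos; rewrite cos_0; f_equal; ring).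
apply lim0_continuous. eapply is_derive_continuous, is_derive_lcos. rewrite cos_0. lra.
Qed.

Lemma lim0_gauge_bound (f : R -> R) (K : R) :
  (forall x, 0 < x < PI / 4 -> Rabs (f x) <= K * sin_gauge x) -> lim0 f 0.
Proof.
intros H. pose proof PI_RGT_0.
apply (lim0_squeeze (PI / 4) f (fun x => K * sin_gauge x)); [lra|exact H|].
rewrite <- (Rmult_0_r K). apply lim0_scal, lim0_sin_gauge.
Qed.

Lemma lim0_arc_polylog (p : C -> R) (s : nat) : real_functional p -> (2 <= s)%nat ->
  lim0 (fun x => polylog p s (arc_path x)) 0.
Proof.
intros Hp Hs. pose proof PI_RGT_0.
apply (lim0_gauge_bound _ (Series (fun m => / INR (S m) ^ s))).
intros x Hx. eapply Rle_trans; [apply arc_polylog_bound; [assumption..|lra]|].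
destruct (sin_gauge_bounds x ltac:(lra)) as [H1 _].
assert (0 < sin x) by (apply sin_gt_0; lra).
apply Rmult_le_compat_l; [|lra].
apply Rle_trans with (Rabs (polylog p s (arc_path (PI / 4))) / sin (PI / 4)).
- apply Rdiv_le_0_compat; [apply Rabs_pos|apply sin_gt_0; lra].
- apply Rle_div_l; [apply sin_gt_0; lra|]. apply arc_polylog_bound; [assumption..|lra].
Qed.

Lemma lim0_lsin_arc_Im2 : lim0 (fun x => lsin x * arc_Im2 x) 0.
Proof.
pose proof PI_RGT_0.
apply (lim0_gauge_bound _ (Rabs (Series (fun m => / INR (S m) ^ 2)))).
intros x Hx. destruct (sin_gauge_bounds x ltac:(lra)) as [H1 [H2 _]].
assert (Hs : 0 < sin x) by (apply sin_gt_0; lra).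
pose proof (arc_polylog_bound Im 2 x real_functional_Im (le_n _) ltac:(lra)) as H3.
fold (arc_Im2 x) in H3. rewrite Rabs_mult.
set (K := Series (fun m => / INR (S m) ^ 2)) in *.
pose proof (Rabs_pos (lsin x)) as H4. pose proof (Rabs_pos K). pose proof (RRle_abs K).
apply Rle_trans with (Rabs (lsin x) * (Rabs K * sin x)).
- apply Rmult_le_compat_l; [exact H4|]. nra.
- replace (Rabs (lsin x) * (Rabs K * sin x)) with (Rabs K * (sin x * Rabs (lsin x))) by ring.
  apply Rmult_le_compat_l; [lra|]. nra.
Qed.

Lemma lim0_x_lsin : lim0 (fun x => x * lsin x) 0.
Proof.
pose proof PI_RGT_0. apply (lim0_gauge_bound _ 1).
intros x Hx. destruct (sin_gauge_bounds x ltac:(lra)) as [H1 [H2 _]].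
pose proof (x_le_2_sin x ltac:(lra)). pose proof (Rabs_pos (lsin x)).
rewrite Rabs_mult, (Rabs_pos_eq x) by lra. nra.
Qed.

Lemma lim0_x_lsin_sq : lim0 (fun x => x * lsin x ^ 2) 0.
Proof.
pose proof PI_RGT_0. apply (lim0_gauge_bound _ 1).
intros x Hx. destruct (sin_gauge_bounds x ltac:(lra)) as [H1 [_ H2]].
pose proof (x_le_2_sin x ltac:(lra)). pose proof (pow2_ge_0 (lsin x)).
rewrite Rabs_pos_eq; nra.
Qed.

Lemma lim0_coarc_polylog (p : C -> R) (s : nat) : real_functional p -> (2 <= s)%nat ->
  lim0 (fun x => polylog p s (arc_path (PI / 2 - x))) (polylog p s (1, 0)).
Proof.
intros Hp Hs.
apply (filterlim_polylog (at_right 0) p s (fun x => sin (PI / 2 - x) ^ 2)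
   (fun x => sin (PI / 2 - x) * cos (PI / 2 - x))); [assumption|assumption| | | |].
- apply filter_forall. intros x. apply Cmod_le_1.
  pose proof (sin_cos_sq (PI / 2 - x)). pose proof (pow2_ge_0 (sin (PI / 2 - x))).
  pose proof (pow2_ge_0 (cos (PI / 2 - x))). nra.
- apply Cmod_le_1. lra.
- replace 1 with (sin (PI / 2 - 0) ^ 2) by (rewrite Rminus_0_r, sin_PI2; ring).
  apply (lim0_continuous (fun x => sin (PI / 2 - x) ^ 2)).
  apply (ex_derive_continuous (fun x => sin (PI / 2 - x) ^ 2)). auto_derive. trivial.
- replace 0 with (sin (PI / 2 - 0) * cos (PI / 2 - 0)) at 2 by (rewrite Rminus_0_r, cos_PI2; ring).
  apply (lim0_continuous (fun x => sin (PI / 2 - x) * cos (PI / 2 - x))).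
  apply (ex_derive_continuous (fun x => sin (PI / 2 - x) * cos (PI / 2 - x))). auto_derive. trivial.
Qed.

Lemma lim0_arc_word : lim0 arc_word 0.
Proof.
unfold arc_word.
replace 0 with (0 - 0 + 0 * 0 - ln 2 * 0) at 1 by ring.
apply (lim0_minus (fun x => arc_Im3 x - lsin x * arc_Im2 x + x * arc_Re2 x) (fun x => ln 2 * x * lsin x)).
- apply (lim0_plus (fun x => arc_Im3 x - lsin x * arc_Im2 x) (fun x => x * arc_Re2 x)).
  + apply (lim0_minus arc_Im3 (fun x => lsin x * arc_Im2 x)).
    * apply lim0_arc_polylog; [apply real_functional_Im|lia].
    * apply lim0_lsin_arc_Im2.
  + apply (lim0_mult (fun x => x) arc_Re2); [apply lim0_id|].
    apply lim0_arc_polylog; [apply real_functional_Re|lia].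
- apply (lim0_ext 1 (fun x => ln 2 * (x * lsin x))); [lra|intros; ring|].
  apply lim0_scal, lim0_x_lsin.
Qed.

Lemma lim0_coarc_word : lim0 coarc_word 0.
Proof.
unfold coarc_word.
replace 0 with (0 - ln 2 * 0 - 0 * polylog Re 2 (1, 0) + ln 2 * 0 * ln 2) at 1 by ring.
apply (lim0_plus (fun x => coarc_Im3 x - lcos x * coarc_Im2 x - x * coarc_Re2 x) (fun x => ln 2 * x * lcos x)).
- apply (lim0_minus (fun x => coarc_Im3 x - lcos x * coarc_Im2 x) (fun x => x * coarc_Re2 x)).
  + apply (lim0_minus coarc_Im3 (fun x => lcos x * coarc_Im2 x)).
    * rewrite <- (polylog_Im_real 3 1). apply lim0_coarc_polylog; [apply real_functional_Im|lia].
    * apply (lim0_mult lcos coarc_Im2); [apply lim0_lcos|].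
      rewrite <- (polylog_Im_real 2 1). apply lim0_coarc_polylog; [apply real_functional_Im|lia].
  + apply (lim0_mult (fun x => x) coarc_Re2); [apply lim0_id|].
    apply lim0_coarc_polylog; [apply real_functional_Re|lia].
- apply (lim0_mult (fun x => ln 2 * x) lcos); [|apply lim0_lcos].
  apply lim0_scal, lim0_id.
Qed.

Lemma line_word_continuous (x : R) : 0 <= x <= PI / 4 -> continuous line_word x.
Proof.
intros Hx. pose proof PI_RGT_0.
eapply is_derive_continuous, is_derive_line_word; [lra|now apply cos_gt_half].
Qed.

Lemma line_word_0 : line_word 0 = 0.
Proof.
unfold line_word, line_Im3, line_Im2, line_path. rewrite sin_0, cos_0.
replace (0 / (2 * 1)) with 0 by field. rewrite !polylog_Im_real. field.
Qed.

Lemma lim0_line_word : lim0 line_word 0.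
Proof.
pose proof PI_RGT_0. rewrite <- line_word_0 at 1.
apply lim0_continuous, line_word_continuous. lra.
Qed.

Lemma arcsin_quot_bound (t : R) : Rabs (arcsin_quot t) <= Series (fun n => / INR (S n) ^ 2).
Proof.
apply Series_dominated; [now apply ex_series_inv_pow|].
intros n. apply arcsin_quot_term_bound, sin_sq_bound.
Qed.

(** The factor sin(2x) absorbs the logarithmic singularity, [arcsin_quot] being bounded. *)
Lemma lim0_target_prim : lim0 target_prim 0.
Proof.
pose proof PI_RGT_0.
set (w := fun x => sin (2 * x) * arcsin_quot (2 * x)).
set (I := fun x => RInt arcsin_quot 0 (2 * x) : R).
apply (lim0_ext 1 (fun x => / 2 * (lsin x * w x - lcos x * w x - I x))); [lra| |].
{ intros x Hx. unfold target_prim, w, I. field. }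
assert (Hw : continuous w 0).
{ apply (continuous_mult (fun x => sin (2 * x)) (fun x => arcsin_quot (2 * x))).
  - apply (ex_derive_continuous (fun x => sin (2 * x))). auto_derive. trivial.
  - apply (continuous_comp (fun x => 2 * x) arcsin_quot); [|apply arcsin_quot_continuous].
    apply (ex_derive_continuous (fun x => 2 * x)). auto_derive. trivial. }
assert (Hw0 : w 0 = 0) by (unfold w; rewrite Rmult_0_r, sin_0; ring).
assert (HI : continuous I 0).
{ eapply is_derive_continuous, (is_derive_dilate2 (fun y => RInt arcsin_quot 0 y)).
  apply is_derive_RInt_arcsin_quot. }
assert (HI0 : I 0 = 0) by (unfold I; rewrite Rmult_0_r, RInt_point; reflexivity).
replace 0 with (/ 2 * (0 - ln 2 * 0 - 0)) at 1 by ring.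
apply lim0_scal.
apply (lim0_minus (fun x => lsin x * w x - lcos x * w x) I).
2: { rewrite <- HI0 at 1. now apply lim0_continuous. }
apply (lim0_minus (fun x => lsin x * w x) (fun x => lcos x * w x)).
2: { apply (lim0_mult lcos w); [apply lim0_lcos|]. rewrite <- Hw0 at 1. now apply lim0_continuous. }
apply (lim0_gauge_bound _ (Series (fun n => / INR (S n) ^ 2))).
intros x Hx. unfold w. destruct (trig_pos x ltac:(lra)) as [Hs Hc].
destruct (sin_gauge_bounds x ltac:(lra)) as [_ [H2 _]].
pose proof (arcsin_quot_bound (2 * x)) as H3. pose proof (Rabs_pos (arcsin_quot (2 * x))) as H4.
pose proof (Rabs_pos (lsin x)) as H5. pose proof (COS_bound x) as H6.
rewrite sin_2a, !Rabs_mult, (Rabs_pos_eq 2), (Rabs_pos_eq (sin x)), (Rabs_pos_eq (cos x)) by lra.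
rewrite Rmult_comm.
replace (2 * sin x * cos x * Rabs (arcsin_quot (2 * x)) * Rabs (lsin x)) with
 (Rabs (arcsin_quot (2 * x)) * (cos x * (2 * sin x * Rabs (lsin x)))) by ring.
assert (H7 : 0 <= 2 * sin x * Rabs (lsin x)) by (apply Rmult_le_pos; lra).
apply Rmult_le_compat; [exact H4|apply Rmult_le_pos; lra|exact H3|]. nra.
Qed.

(** Only [- PI / 2 * lcos x ^ 2] has a nonzero limit. The square is expanded so that each [lsin]
    outside the words shows its factor [x]. *)
Lemma lim0_lntan_sq_prim : lim0 lntan_sq_prim (- (PI / 2) * ln 2 ^ 2).
Proof.
unfold lntan_sq_prim.
apply (lim0_ext 1 (fun x => 2 * (arc_word x - coarc_word x) +
  (x * lsin x ^ 2 + 2 * ((x * lsin x) * lcos x) + x * (lcos x * lcos x))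
  - PI / 2 * (lcos x * lcos x) + x * (- (4 / 3) * (x * x) + PI / 2 * x))); [lra|intros; field|].
replace (- (PI / 2) * ln 2 ^ 2) with (2 * (0 - 0) + (0 + 2 * (0 * ln 2) + 0 * (ln 2 * ln 2))
  - PI / 2 * (ln 2 * ln 2) + 0 * (- (4 / 3) * (0 * 0) + PI / 2 * 0)) by ring.
pose proof lim0_lcos as Hc. pose proof lim0_id as Hid.
pose proof lim0_x_lsin as H1. pose proof lim0_x_lsin_sq as H2.
pose proof lim0_arc_word as H3. pose proof lim0_coarc_word as H4.
repeat first [ assumption
  | apply lim0_scal | apply (lim0_minus (fun x => _) (fun x => _))
  | apply (lim0_plus (fun x => _) (fun x => _)) | apply (lim0_mult (fun x => _) (fun x => _)) ].
Qed.

(** * Values at pi/4 *)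

Lemma sin_sq_PI4 : sin (PI / 4) ^ 2 = 1 / 2 /\ cos (PI / 4) = sin (PI / 4) /\ 0 < sin (PI / 4).
Proof.
pose proof PI_RGT_0. pose proof (sin_cos_sq (PI / 4)) as E.
assert (Ec : cos (PI / 4) = sin (PI / 4)) by (rewrite sin_PI4, cos_PI4; reflexivity).
rewrite Ec in E. repeat split; [lra|exact Ec|apply sin_gt_0; lra].
Qed.

Lemma lsin_PI4 : lsin (PI / 4) = ln 2 / 2.
Proof.
destruct sin_sq_PI4 as [E [_ Hs]]. unfold lsin.
assert (H : ln ((2 * sin (PI / 4)) ^ 2) = ln 2) by (f_equal; replace ((2 * sin (PI / 4)) ^ 2) with (4 * sin (PI / 4) ^ 2) by ring; rewrite E; field).
rewrite ln_sq in H by lra. lra.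
Qed.

Lemma lcos_PI4 : lcos (PI / 4) = ln 2 / 2.
Proof. rewrite <- lsin_PI4. unfold lcos, lsin. destruct sin_sq_PI4 as [_ [-> _]]. reflexivity. Qed.

Lemma arc_path_PI4 : arc_path (PI / 4) = (1 / 2, 1 / 2).
Proof.
destruct sin_sq_PI4 as [E [Ec _]]. unfold arc_path. rewrite Ec.
replace (sin (PI / 4) * sin (PI / 4)) with (sin (PI / 4) ^ 2) by ring. now rewrite E.
Qed.

Lemma line_path_PI4 : line_path (PI / 4) = (1 / 2, 1 / 2).
Proof.
destruct sin_sq_PI4 as [_ [Ec Hs]]. unfold line_path. rewrite Ec. f_equal. field. lra.
Qed.

Lemma PI4_reflect : PI / 2 - PI / 4 = PI / 4.
Proof. field. Qed.

(** * The real part of the dilogarithm at (1+i)/2 *)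

Lemma neg_ln_cos_bound (x : R) : 0 < x < PI / 4 -> 0 <= ln 2 - lcos x <= 2 * sin x.
Proof.
intros Hx. pose proof PI_RGT_0. destruct (trig_pos x ltac:(lra)) as [Hs Hc].
pose proof (cos_gt_half x ltac:(lra)) as Hh. pose proof (COS_bound x) as Hb. pose proof (SIN_bound x).
pose proof (sin_cos_sq x) as E.
unfold lcos. rewrite ln_double by exact Hc.
replace (ln 2 - (ln 2 + ln (cos x))) with (ln (/ cos x)) by (rewrite ln_Rinv by exact Hc; ring).
assert (H1 : 1 <= / cos x) by (rewrite <- Rinv_1; apply Rinv_le_contravar; lra).
split.
- rewrite <- ln_1. destruct (Rle_lt_or_eq_dec _ _ H1) as [H2|<-]; [left; apply ln_increasing; lra|lra].
- eapply Rle_trans; [apply ln_le_minus_1; lra|].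
  replace (/ cos x - 1) with ((1 - cos x) / cos x) by (field; lra).
  apply Rle_div_l; [exact Hc|]. nra.
Qed.

(** Euler's reflection formula for z = [arc_path x]: the reflected path is the conjugate of 1 - z,
    and the elementary terms of [f] are the real part of log(z) log(1 - z), where log z = ln(sin x)
    + i (pi/2 - x) and log(1 - z) = ln(cos x) - i x. *)
Lemma dilog_reflection_PI4 : polylog Re 2 (1, 0) = 2 * arc_Re2 (PI / 4) + ln 2 ^ 2 / 4 + PI ^ 2 / 16.
Proof.
pose proof PI_RGT_0.
set (f := fun x => arc_Re2 x + coarc_Re2 x + (lsin x - ln 2) * (lcos x - ln 2) + x * (PI / 2 - x)).
assert (Hf : forall x, 0 < x < PI / 2 -> is_derive f x 0).
{ intros x Hx. destruct (trig_pos x Hx) as [Hs Hc].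
  pose proof (is_derive_arc_Re_2 x Hx : is_derive arc_Re2 x _) as H1.
  pose proof (is_derive_coarc_Re2 x Hx) as H2.
  pose proof (is_derive_lsin x Hs) as H3. pose proof (is_derive_lcos x Hc) as H4.
  unfold f. revert H1 H2 H3 H4. generalize (sin x / cos x) (cos x / sin x). intros k t H1 H2 H3 H4.
  derive_with. ring. }
assert (E : f (PI / 4) = polylog Re 2 (1, 0)).
{ apply (zero_derive_continuous f (PI / 4)); [lra| | |].
  - intros x Hx. apply Hf. lra.
  - replace (polylog Re 2 (1, 0)) with (0 + polylog Re 2 (1, 0) + 0 + 0 * (PI / 2 - 0)) by ring.
    unfold f.
    apply (lim0_plus (fun x => arc_Re2 x + coarc_Re2 x + (lsin x - ln 2) * (lcos x - ln 2)) (fun x => x * (PI / 2 - x))).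
    + apply (lim0_plus (fun x => arc_Re2 x + coarc_Re2 x) (fun x => (lsin x - ln 2) * (lcos x - ln 2))).
      * apply (lim0_plus arc_Re2 coarc_Re2).
        -- apply lim0_arc_polylog; [apply real_functional_Re|lia].
        -- apply lim0_coarc_polylog; [apply real_functional_Re|lia].
      (* The factor [lcos x - ln 2], that is ln(cos x), is O(sin x) and compensates the singular
         [lsin]. *)
      * apply (lim0_gauge_bound _ (1 + ln 2)). intros x Hx.
        destruct (sin_gauge_bounds x ltac:(lra)) as [H1 [H2 _]].
        pose proof (neg_ln_cos_bound x Hx) as H3. pose proof (Rabs_pos (lsin x)).
        assert (Hl : 0 < ln 2) by (rewrite <- ln_1; apply ln_increasing; lra).
        assert (H4 : Rabs (lsin x - ln 2) <= Rabs (lsin x) + ln 2).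
        { eapply Rle_trans; [apply Rabs_triang|]. rewrite Rabs_Ropp, (Rabs_pos_eq (ln 2)) by lra. lra. }
        rewrite Rabs_mult, <- (Rabs_Ropp (lcos x - ln 2)), (Rabs_pos_eq (- (lcos x - ln 2))) by lra.
        pose proof (Rabs_pos (lsin x - ln 2)).
        apply Rle_trans with ((Rabs (lsin x) + ln 2) * (2 * sin x)); [apply Rmult_le_compat; lra|]. nra.
    + apply (lim0_mult (fun x => x) (fun x => PI / 2 - x)); [apply lim0_id|].
      apply (lim0_minus (fun _ => PI / 2) (fun x => x)); [apply lim0_const|apply lim0_id].
  - eapply is_derive_continuous, Hf. lra. }
rewrite <- E. unfold f, coarc_Re2. rewrite PI4_reflect, lsin_PI4, lcos_PI4. field.
Qed.

(** Landen's formula Li2(w) + Li2(w/(w-1)) = - log(1-w)^2/2 at w = - i tan x, where log(1 - w) = -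
    ln(cos x) + i x. *)
Lemma dilog_landen_PI4 : arc_Re2 (PI / 4) + polylog Re 2 (0, 1) + ln 2 ^ 2 / 8 - PI ^ 2 / 32 = 0.
Proof.
pose proof PI_RGT_0.
set (f := fun x => arc_Re2 x + imag_Re2 x + ((lcos x - ln 2) * (lcos x - ln 2) - x * x) / 2).
assert (Hsc : forall x, 0 < x < PI / 4 -> 0 < sin x < cos x).
{ intros x Hx. split; [apply sin_gt_0; lra|]. rewrite <- sin_shift. apply sin_increasing_1; lra. }
symmetry. apply (zero_derive_endpoints f (PI / 4)); [lra| | |].
- intros x Hx. destruct (trig_pos x ltac:(lra)) as [Hs Hc].
  pose proof (is_derive_arc_Re_2 x ltac:(lra) : is_derive arc_Re2 x _) as H1.
  pose proof (is_derive_imag_Re_2 x ltac:(lra) (proj2 (Hsc x Hx)) : is_derive imag_Re2 x _) as H2.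
  pose proof (is_derive_lcos x Hc) as H4.
  unfold f. revert H1 H2 H4. generalize (sin x / cos x) (cos x / sin x). intros k t H1 H2 H4.
  derive_with. field.
- apply (lim0_ext 1 (fun x => arc_Re2 x + imag_Re2 x + / 2 * ((lcos x - ln 2) * (lcos x - ln 2) - x * x))); [lra|intros; unfold f; field|].
  assert (H1 : lim0 arc_Re2 0) by (apply lim0_arc_polylog; [apply real_functional_Re|lia]).
  assert (H2 : lim0 imag_Re2 0).
  { rewrite <- (polylog_0_r Re 2 real_functional_Re).
    apply (filterlim_polylog (at_right 0) Re 2 (fun _ => 0) (fun x => sin x / cos x)); [apply real_functional_Re|lia| | | |].
    - eapply filter_imp; [|exact (at_right_0_lt (PI / 4) ltac:(lra))]. intros x Hx. cbv beta.
      destruct (Hsc x Hx) as [Ha Hb]. apply Cmod_le_1.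
      assert (0 < sin x / cos x < 1) by (split; [apply Rdiv_lt_0_compat; lra|apply Rlt_div_l; lra]). nra.
    - apply Cmod_le_1. lra.
    - apply filterlim_const.
    - replace 0 with (sin 0 / cos 0) at 2 by (rewrite sin_0, cos_0; field).
      apply (lim0_continuous (fun x => sin x / cos x)).
      apply (ex_derive_continuous (fun x => sin x / cos x)). auto_derive. rewrite cos_0. lra. }
  pose proof lim0_lcos as H3. pose proof lim0_id as H4. pose proof (lim0_const (ln 2)) as H5.
  replace 0 with (0 + 0 + / 2 * ((ln 2 - ln 2) * (ln 2 - ln 2) - 0 * 0)) by ring.
  repeat first [ assumption
  | apply lim0_scal | apply (lim0_minus (fun x => _) (fun x => _))
  | apply (lim0_plus (fun x => _) (fun x => _)) | apply (lim0_mult (fun x => _) (fun x => _)) ].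
(* At pi/4 the imaginary path meets the unit circle at i: [imag_Re2] is handled by a left limit, the
   rest [g] by differentiability. *)
- set (g := fun x => arc_Re2 x + ((lcos x - ln 2) * (lcos x - ln 2) - x * x) / 2).
  apply (filterlim_ext (fun x => g x + imag_Re2 x)); [intros; unfold f, g; ring|].
  replace (arc_Re2 (PI / 4) + polylog Re 2 (0, 1) + ln 2 ^ 2 / 8 - PI ^ 2 / 32) with (g (PI / 4) + polylog Re 2 (0, 1))
    by (unfold g; rewrite lcos_PI4; field).
  apply (filterlim_comp_2 (G := locally (g (PI / 4))) (H := locally (polylog Re 2 (0, 1))) g imag_Re2 Rplus).
  3: { apply (@filterlim_plus R_AbsRing R_NormedModule (g (PI / 4)) (polylog Re 2 (0, 1))). }
  + eapply filterlim_filter_le_1; [apply filter_le_within|].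
    assert (Hd : ex_derive g (PI / 4)).
    { pose proof (is_derive_arc_Re_2 (PI / 4) ltac:(lra) : is_derive arc_Re2 (PI / 4) _) as H1.
      pose proof (is_derive_lcos (PI / 4) (proj2 (trig_pos (PI / 4) ltac:(lra)))) as H2.
      unfold g. auto_derive. repeat split; eexists; eassumption. }
    exact (ex_derive_continuous g (PI / 4) Hd).
  + apply (filterlim_polylog (at_left (PI / 4)) Re 2 (fun _ => 0) (fun x => sin x / cos x)); [apply real_functional_Re|lia| | | |].
    * exists (mkposreal (PI / 4) ltac:(lra)). intros x Hx Hxb. change (Rabs (x - PI / 4) < PI / 4) in Hx. apply Rabs_def2 in Hx.
      destruct (Hsc x ltac:(lra)) as [Ha Hb]. apply Cmod_le_1.
      assert (0 < sin x / cos x < 1) by (split; [apply Rdiv_lt_0_compat; lra|apply Rlt_div_l; lra]). nra.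
    * apply Cmod_le_1. lra.
    * apply filterlim_const.
    * destruct sin_sq_PI4 as [_ [Ec Hs]].
      replace 1 with (sin (PI / 4) / cos (PI / 4)) by (rewrite Ec; field; lra).
      eapply filterlim_filter_le_1; [apply filter_le_within|].
      apply (ex_derive_continuous (fun x => sin x / cos x)). auto_derive. lra.
Qed.

Lemma arc_Re2_PI4 : arc_Re2 (PI / 4) = 5 * PI ^ 2 / 96 - ln 2 ^ 2 / 8.
Proof.
pose proof dilog_reflection_PI4 as H1. pose proof dilog_landen_PI4 as H2.
rewrite polylog_Re_2_Ci, H1 in H2. lra.
Qed.

(** * The linear equation at pi/4 *)

Lemma arc_word_PI4 : arc_word (PI / 4) =
  polylog Im 3 (1 / 2, 1 / 2) - ln 2 / 2 * polylog Im 2 (1 / 2, 1 / 2)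
   + PI / 4 * (5 * PI ^ 2 / 96 - ln 2 ^ 2 / 8) - PI * ln 2 ^ 2 / 8.
Proof.
unfold arc_word. rewrite arc_Re2_PI4, lsin_PI4. unfold arc_Im3, arc_Im2. rewrite arc_path_PI4. field.
Qed.

Lemma coarc_word_PI4 : coarc_word (PI / 4) =
  polylog Im 3 (1 / 2, 1 / 2) - ln 2 / 2 * polylog Im 2 (1 / 2, 1 / 2)
   - PI / 4 * (5 * PI ^ 2 / 96 - ln 2 ^ 2 / 8) + PI * ln 2 ^ 2 / 8.
Proof.
unfold coarc_word, coarc_Im3, coarc_Im2, coarc_Re2. rewrite PI4_reflect, arc_Re2_PI4, lcos_PI4.
unfold arc_Im3, arc_Im2. rewrite arc_path_PI4. field.
Qed.

Lemma line_word_PI4 : line_word (PI / 4) =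
  polylog Im 3 (1 / 2, 1 / 2) + ln 2 / 2 * polylog Im 2 (1 / 2, 1 / 2)
   - PI / 4 * (5 * PI ^ 2 / 96 - ln 2 ^ 2 / 8) - PI ^ 3 / 192.
Proof.
unfold line_word, line_Im3, line_Im2, line_Re2. rewrite line_path_PI4, <- arc_path_PI4.
fold (arc_Re2 (PI / 4)). rewrite arc_Re2_PI4, arc_path_PI4, lcos_PI4. field.
Qed.

Lemma lsin_sq_prim_PI4 : lsin_sq_prim (PI / 4) = 0.
Proof. exact (RInt_point (V := R_CompleteNormedModule) (PI / 4) (fun t => lsin t ^ 2)). Qed.

(** Reflection turns the integral of [lsin ^ 2] over [pi/4, pi/2] into that of [lcos ^ 2] over
    [0, pi/4], whose antiderivative [line_word] vanishes at 0. *)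
Lemma lsin_sq_prim_PI2 : lsin_sq_prim (PI / 2) = line_word (PI / 4).
Proof.
pose proof PI_RGT_0.
assert (E : lsin_sq_prim (PI / 2 - 0) + line_word 0 = lsin_sq_prim (PI / 2 - PI / 4) + line_word (PI / 4)).
{ apply (eq_is_derive (fun x => lsin_sq_prim (PI / 2 - x) + line_word x)); [|lra].
  intros x Hx.
  pose proof (is_derive_reflect _ _ _ (is_derive_lsin_sq_prim (PI / 2 - x) ltac:(lra))) as H1.
  rewrite lsin_reflect in H1.
  pose proof (is_derive_line_word x ltac:(lra) (cos_gt_half x Hx)) as H2.
  evar_last; [exact (is_derive_plus _ _ _ _ _ H1 H2)|]. change (@eq R (- lcos x ^ 2 + lcos x ^ 2) 0). ring. }
rewrite PI4_reflect, lsin_sq_prim_PI4, line_word_0, Rminus_0_r in E. lra.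
Qed.

(* [prim_defect + lsin_sq_prim] is constant; in particular [lsin_sq_prim] has a limit at 0, so no improper integral is needed. *)
Definition prim_defect (x : R) : R :=
  target_prim x - arc_word x - coarc_word x - line_word x
  - x * lsin x ^ 2 + x * lcos x ^ 2 - PI / 4 * lcos x ^ 2 + PI / 4 * x ^ 2.

Lemma target_prim_continuous (x : R) : 0 < x < PI / 2 -> continuous target_prim x.
Proof.
intros Hx. destruct (trig_pos x Hx) as [Hs Hc].
unfold target_prim.
apply (continuous_mult (fun x => (lsin x - lcos x) * (sin (2 * x) * arcsin_quot (2 * x)) - RInt arcsin_quot 0 (2 * x)) (fun _ => / 2));
 [|apply continuous_const].
apply (continuous_minus (V := R_NormedModule) (fun x => (lsin x - lcos x) * (sin (2 * x) * arcsin_quot (2 * x))) (fun x => RInt arcsin_quot 0 (2 * x))).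
- apply (continuous_mult (fun x => lsin x - lcos x) (fun x => sin (2 * x) * arcsin_quot (2 * x))).
  + apply (continuous_minus (V := R_NormedModule) lsin lcos); eapply is_derive_continuous;
      [now apply is_derive_lsin|now apply is_derive_lcos].
  + apply (continuous_mult (fun x => sin (2 * x)) (fun x => arcsin_quot (2 * x))).
    * apply (ex_derive_continuous (fun x => sin (2 * x))). auto_derive. trivial.
    * apply (continuous_comp (fun x => 2 * x) arcsin_quot); [|apply arcsin_quot_continuous].
      apply (ex_derive_continuous (fun x => 2 * x)). auto_derive. trivial.
- eapply (is_derive_continuous (fun x => RInt arcsin_quot 0 (2 * x))), (is_derive_dilate2 (fun y => RInt arcsin_quot 0 y)).
  apply is_derive_RInt_arcsin_quot.
Qed.

(** The target and the first two words leave x (2 cot x [lsin x] + 2 tan x [lcos x]), which the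
    terms [x * lsin x ^ 2] and [x * lcos x ^ 2] absorb at the price of [lcos ^ 2 - lsin ^ 2];
    [line_word] removes [lcos ^ 2]. The terms with pi/4 cancel what the reflection adds to
    [coarc_word]. *)
Lemma is_derive_prim_defect (x : R) : 0 < x < PI / 4 ->
  is_derive prim_defect x (- lsin x ^ 2).
Proof.
intros Hx. destruct (trig_pos x ltac:(lra)) as [Hs Hc].
pose proof (is_derive_target_prim x Hx) as H1.
pose proof (is_derive_arc_word x ltac:(lra)) as H2.
pose proof (is_derive_coarc_word x ltac:(lra)) as H3.
pose proof (is_derive_line_word x ltac:(lra) (cos_gt_half x ltac:(lra))) as H4.
pose proof (is_derive_lsin x Hs) as H5. pose proof (is_derive_lcos x Hc) as H6.
unfold prim_defect. revert H1 H2 H3 H4 H5 H6. generalize (sin x / cos x) (cos x / sin x).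
intros k t H1 H2 H3 H4 H5 H6.
derive_with. field.
Qed.

Lemma lim0_prim_defect : lim0 prim_defect (- (PI / 4) * ln 2 ^ 2).
Proof.
unfold prim_defect.
apply (lim0_ext 1 (fun x => target_prim x - arc_word x - coarc_word x - line_word x
  - x * lsin x ^ 2 + x * (lcos x * lcos x) - PI / 4 * (lcos x * lcos x) + PI / 4 * (x * x))); [lra|intros; ring|].
replace (- (PI / 4) * ln 2 ^ 2) with (0 - 0 - 0 - 0 - 0 + 0 * (ln 2 * ln 2) - PI / 4 * (ln 2 * ln 2) + PI / 4 * (0 * 0)) by ring.
pose proof lim0_lcos as Hc. pose proof lim0_id as Hid.
pose proof lim0_x_lsin_sq as H2. pose proof lim0_line_word as H5. pose proof lim0_target_prim as H6.
pose proof lim0_arc_word as H3. pose proof lim0_coarc_word as H4.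
repeat first [ assumption
  | apply lim0_scal | apply (lim0_minus (fun x => _) (fun x => _))
  | apply (lim0_plus (fun x => _) (fun x => _)) | apply (lim0_mult (fun x => _) (fun x => _)) ].
Qed.

Lemma prim_defect_continuous_PI4 : continuous prim_defect (PI / 4).
Proof.
pose proof PI_RGT_0. destruct (trig_pos (PI / 4) ltac:(lra)) as [Hs Hc].
pose proof (is_derive_arc_word (PI / 4) ltac:(lra)) as H2.
pose proof (is_derive_coarc_word (PI / 4) ltac:(lra)) as H3.
pose proof (is_derive_line_word (PI / 4) ltac:(lra) (cos_gt_half (PI / 4) ltac:(lra))) as H4.
pose proof (is_derive_lsin (PI / 4) Hs) as H5. pose proof (is_derive_lcos (PI / 4) Hc) as H6.
set (f := fun x => - arc_word x - coarc_word x - line_word x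
  - x * lsin x ^ 2 + x * lcos x ^ 2 - PI / 4 * lcos x ^ 2 + PI / 4 * x ^ 2).
apply (continuous_ext (fun x => plus (target_prim x) (f x))).
{ intros x. change (@eq R (target_prim x + f x) (prim_defect x)). unfold prim_defect, f. ring. }
apply (continuous_plus (V := R_NormedModule) target_prim f); [apply target_prim_continuous; lra|].
apply (ex_derive_continuous f). unfold f. auto_derive. repeat split; eexists; eassumption.
Qed.

Lemma prim_defect_lsin_sq_prim (x : R) : 0 < x < PI / 4 ->
  lsin_sq_prim x = prim_defect (PI / 4) - prim_defect x.
Proof.
intros Hx. pose proof PI_RGT_0.
assert (Hb : forall t, 0 < t < PI -> continuous lsin_sq_prim t).
{ intros t Ht. eapply is_derive_continuous, is_derive_lsin_sq_prim, Ht. }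
(* The mean value theorem asks only for continuity at pi/4, where the derivative of [target_prim]
   has not been computed. *)
destruct (MVT_gen (fun t => prim_defect t + lsin_sq_prim t) x (PI / 4) (fun _ => 0)) as [c [_ E]].
- rewrite Rmin_left, Rmax_right by lra. intros t Ht.
  evar_last; [exact (is_derive_plus _ _ _ _ _ (is_derive_prim_defect t ltac:(lra))
    (is_derive_lsin_sq_prim t ltac:(lra)))|]. 
  change (@eq R (- lsin t ^ 2 + lsin t ^ 2) 0). ring.
- rewrite Rmin_left, Rmax_right by lra. intros t Ht.
  apply continuity_pt_filterlim.
  apply (continuous_plus (V := R_NormedModule) prim_defect lsin_sq_prim); [|apply Hb; lra].
  destruct (Rle_lt_or_eq_dec t (PI / 4) (proj2 Ht)) as [H1| ->].
  + eapply is_derive_continuous, is_derive_prim_defect. lra.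
  + apply prim_defect_continuous_PI4.
- rewrite lsin_sq_prim_PI4 in E. lra.
Qed.

(** The limit is minus the integral of [lsin ^ 2] over [0, pi/4], expressed through the integral
    sought, which sits in [prim_defect (PI / 4)]. *)
Lemma lim0_lsin_sq_prim : lim0 lsin_sq_prim (prim_defect (PI / 4) + PI / 4 * ln 2 ^ 2).
Proof.
pose proof PI_RGT_0.
apply (lim0_ext (PI / 4) (fun x => prim_defect (PI / 4) - prim_defect x)); [lra| |].
- intros x Hx. symmetry. now apply prim_defect_lsin_sq_prim.
- replace (prim_defect (PI / 4) + PI / 4 * ln 2 ^ 2) with (prim_defect (PI / 4) - - (PI / 4) * ln 2 ^ 2) by ring.
  apply (lim0_minus (fun _ => prim_defect (PI / 4)) prim_defect); [apply lim0_const|apply lim0_prim_defect].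
Qed.

Lemma lim0_dilate2 (f : R -> R) (l : R) : lim0 f l -> lim0 (fun x => f (2 * x)) l.
Proof.
intros H. apply (filterlim_comp _ _ _ (fun x => 2 * x) f (at_right 0) (at_right 0)); [|exact H].
intros P [e He]. exists (mkposreal (e / 2) ltac:(destruct e; simpl; lra)).
intros y Hy Hy0. change (Rabs (y - 0) < e / 2) in Hy. apply Rabs_def2 in Hy.
apply He; [|lra]. change (Rabs (2 * y - 0) < e). apply Rabs_def1; lra.
Qed.

Lemma lsin_dilate2 (x : R) : 0 < x < PI / 2 -> lsin (2 * x) = lsin x + lcos x.
Proof.
intros Hx. destruct (trig_pos x Hx) as [Hs Hc]. unfold lsin, lcos.
rewrite <- ln_mult by lra. f_equal. rewrite sin_2a. ring.
Qed.

(* Integrates [2 (lsin x ^ 2 + lcos x ^ 2) = (lsin x - lcos x) ^ 2 + lsin (2 * x) ^ 2] over [0, PI/4]. *)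
Lemma lsin_sq_duplication :
  2 * line_word (PI / 4) - lntan_sq_prim (PI / 4) - lsin_sq_prim (PI / 2) / 2
  = 3 / 2 * (prim_defect (PI / 4) + PI / 4 * ln 2 ^ 2) + PI / 2 * ln 2 ^ 2.
Proof.
pose proof PI_RGT_0.
set (f := fun x => 2 * (lsin_sq_prim x + line_word x) - lntan_sq_prim x - / 2 * lsin_sq_prim (2 * x)).
assert (Hf : forall x, 0 < x <= PI / 4 -> is_derive f x 0).
{ intros x Hx.
  set (g := fun t => lsin_sq_prim (2 * t)).
  pose proof (is_derive_lsin_sq_prim x ltac:(lra)) as H1.
  pose proof (is_derive_dilate2 _ _ _ (is_derive_lsin_sq_prim (2 * x) ltac:(lra)) : is_derive g x _) as H2.
  pose proof (is_derive_line_word x ltac:(lra) (cos_gt_half x ltac:(lra))) as H3.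
  pose proof (is_derive_lntan_sq_prim x ltac:(lra)) as H4.
  rewrite lsin_dilate2 in H2 by lra.
  apply (is_derive_ext (fun x => 2 * (lsin_sq_prim x + line_word x) - lntan_sq_prim x - / 2 * g x)); [reflexivity|].
  derive_with. field. }
assert (E : f (PI / 4) = 2 * (prim_defect (PI / 4) + PI / 4 * ln 2 ^ 2 + 0) - - (PI / 2) * ln 2 ^ 2
  - / 2 * (prim_defect (PI / 4) + PI / 4 * ln 2 ^ 2)).
{ apply (zero_derive_continuous f (PI / 4)); [lra| | |].
  - intros x Hx. apply Hf. lra.
  - unfold f. pose proof lim0_lsin_sq_prim as H1. pose proof (lim0_dilate2 _ _ H1) as H2.
    pose proof lim0_line_word as H3. pose proof lim0_lntan_sq_prim as H4.
    repeat first [ assumption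
    | apply lim0_scal | apply (lim0_minus (fun x => _) (fun x => _))
    | apply (lim0_plus (fun x => _) (fun x => _)) ].
  - eapply is_derive_continuous, Hf. lra. }
unfold f in E. replace (2 * (PI / 4)) with (PI / 2) in E by field. rewrite lsin_sq_prim_PI4 in E. lra.
Qed.

(** In the duplication identity Im Li2((1+i)/2) has coefficient 3/4 ln 2 on both sides and drops
    out. Im Li3 has 3/2 on the left and -9/2 on the right, against -3/4 for the integral: hence the
    factor -8. *)
Lemma RInt_arcsin_quot : RInt arcsin_quot 0 (PI / 2) =
  3 * PI ^ 3 / 16 + PI * ln 2 ^ 2 / 4 - 8 * polylog Im 3 (1 / 2, 1 / 2).
Proof.
pose proof lsin_sq_duplication as E. rewrite lsin_sq_prim_PI2 in E.
unfold lntan_sq_prim, prim_defect, target_prim in E.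
rewrite arc_word_PI4, coarc_word_PI4, line_word_PI4, lsin_PI4, lcos_PI4 in E.
replace (2 * (PI / 4)) with (PI / 2) in E by field.
generalize dependent (RInt arcsin_quot 0 (PI / 2) : R). intros I E.
generalize dependent (polylog Im 3 (1 / 2, 1 / 2)). intros L E.
lra.
Qed.

(** * The hypergeometric series *)

Lemma Cpoch_half (n : nat) : Cpoch (1 / 2) n = RtoC (INR (Factorial.fact n) * cbin n).
Proof.
induction n as [|n IH].
- rewrite cbin_0. simpl. f_equal. ring.
- change (Cpoch (1 / 2) (S n)) with (Cpoch (1 / 2) n * (1 / 2 + INR n))%C.
  rewrite IH, <- RtoC_div, <- RtoC_plus, <- RtoC_mult by lra. f_equal.
  rewrite cbin_S. change (Factorial.fact (S n)) with (S n * Factorial.fact n)%nat.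
  rewrite mult_INR, S_INR. pose proof (pos_INR n). field. lra.
Qed.

Lemma Cpoch_one (n : nat) : Cpoch 1 n = RtoC (INR (Factorial.fact n)).
Proof.
induction n as [|n IH]; [reflexivity|].
change (Cpoch 1 (S n)) with (Cpoch 1 n * (1 + INR n))%C.
rewrite IH, <- RtoC_plus, <- RtoC_mult. f_equal.
change (Factorial.fact (S n)) with (S n * Factorial.fact n)%nat.
rewrite mult_INR, S_INR. ring.
Qed.

(** The quotient (3/2)_n / (1/2)_n telescopes to 2n + 1. *)
Lemma Cpoch_three_halves (n : nat) :
  Cpoch (3 / 2) n = RtoC ((2 * INR n + 1) * (INR (Factorial.fact n) * cbin n)).
Proof.
induction n as [|n IH].
- rewrite cbin_0. simpl. f_equal. ring.
- change (Cpoch (3 / 2) (S n)) with (Cpoch (3 / 2) n * (3 / 2 + INR n))%C.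
  rewrite IH, <- RtoC_div, <- RtoC_plus, <- RtoC_mult by lra. f_equal.
  rewrite cbin_S. change (Factorial.fact (S n)) with (S n * Factorial.fact n)%nat.
  rewrite mult_INR, S_INR. pose proof (pos_INR n). field. lra.
Qed.

Lemma hyp4F3_term_cbin (n : nat) :
  hyp4F3_term (1 / 2) (1 / 2) (1 / 2) (1 / 2) 1 (3 / 2) (3 / 2) 1 n =
  RtoC (1 / (2 * INR n + 1) ^ 2 * cbin n ^ 2).
Proof.
unfold hyp4F3_term. rewrite Cpoch_half, Cpoch_one, Cpoch_three_halves, Cpow_1_l.
pose proof (INR_fact_lt_0 n) as Hf. pose proof (proj1 (cbin_pos_le_1 n)) as Hc.
pose proof (odd_ge_1 n) as Ho.
set (f := INR (Factorial.fact n)) in *. set (c := cbin n) in *. set (o := 2 * INR n + 1) in *.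
assert (Hfc : 0 < f * c) by nra.
assert (Hofc : 0 < o * (f * c)) by nra.
rewrite <- !RtoC_mult, <- !RtoC_div, <- !RtoC_mult.
- f_equal. field. lra.
- lra.
- assert (0 < f * (o * (f * c))) by nra. assert (0 < f * (o * (f * c)) * (o * (f * c))) by nra. lra.
Qed.

Lemma is_series_cbin_sq :
  is_series (fun n => 1 / (2 * INR n + 1) ^ 2 * cbin n ^ 2) (2 / PI * RInt arcsin_quot 0 (PI / 2)).
Proof.
pose proof PI_RGT_0.
pose proof (is_series_scal (V := R_NormedModule) (2 / PI) _ _ is_series_arcsin_quot_RInt) as H1.
eapply is_series_ext; [|exact H1].
intros n. pose proof (odd_ge_1 n).
change (@eq R (2 / PI * (PI / 2 * (cbin n / (2 * INR n + 1) ^ 2 * cbin n))) (1 / (2 * INR n + 1) ^ 2 * cbin n ^ 2)).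
field. lra.
Qed.

Lemma Im_Li3_polylog (z : C) : Im (Li3 z) = polylog Im 3 z.
Proof.
unfold Li3, CSeries, polylog. change (Im (?u, ?v)) with v. apply Series_ext. intros m.
unfold Li3_term. pose proof (pow_INR_S_ge_1 m 3).
unfold Cdiv. rewrite <- RtoC_pow, <- RtoC_inv by lra.
generalize (INR (S m) ^ 3) (z ^ S m)%C. intros r [u v]. unfold Im, Cmult, RtoC, Rdiv. simpl. ring.
Qed.

Theorem mainTheorem5 :
  let a := fun n : nat =>
    1 / (2 * INR n + 1) ^ 2 * (1 / 4 ^ n * Binomial.C (2 * n) n) ^ 2 in
  ex_series a /\
  ex_series (hyp4F3_term (1 / 2) (1 / 2) (1 / 2) (1 / 2) 1 (3 / 2) (3 / 2) 1) /\
  RtoC (Series a) = hyp4F3 (1 / 2) (1 / 2) (1 / 2) (1 / 2) 1 (3 / 2) (3 / 2) 1 /\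
  hyp4F3 (1 / 2) (1 / 2) (1 / 2) (1 / 2) 1 (3 / 2) (3 / 2) 1 =
    RtoC (3 * PI ^ 2 / 8 + ln 2 ^ 2 / 2 - 16 / PI * Im (Li3 ((1 + Ci) / 2))).
Proof.
intros a. pose proof PI_RGT_0 as HPI.
assert (Ha : is_series a (2 / PI * RInt arcsin_quot 0 (PI / 2))) by exact is_series_cbin_sq.
assert (Hterm : forall n, hyp4F3_term (1 / 2) (1 / 2) (1 / 2) (1 / 2) 1 (3 / 2) (3 / 2) 1 n = RtoC (a n))
  by exact hyp4F3_term_cbin.
assert (Ha0 : forall n, 0 <= a n).
{ intros n. pose proof (odd_ge_1 n). apply Rmult_le_pos; [|apply pow2_ge_0].
  apply Rdiv_le_0_compat; [lra|]. apply pow_lt. lra. }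
assert (Hhyp : hyp4F3 (1 / 2) (1 / 2) (1 / 2) (1 / 2) 1 (3 / 2) (3 / 2) 1 = RtoC (Series a)).
{ change (RtoC (Series a)) with ((Series a, 0) : C). unfold hyp4F3, CSeries. f_equal.
  - apply Series_ext. intros n. now rewrite Hterm.
  - transitivity (0 * Series (fun _ : nat => 0)); [|ring].
    rewrite <- Series_scal_l. apply Series_ext. intros n. rewrite Hterm. unfold Im, RtoC. simpl snd. ring. }
split; [|split; [|split]].
- eexists. exact Ha.
- apply (@ex_series_le C_AbsRing C_CompleteNormedModule _ a); [|eexists; exact Ha].
  intros n. change (Cmod (hyp4F3_term (1 / 2) (1 / 2) (1 / 2) (1 / 2) 1 (3 / 2) (3 / 2) 1 n) <= a n).
  rewrite Hterm, Cmod_R, Rabs_pos_eq by apply Ha0. lra.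
- now rewrite Hhyp.
- rewrite Hhyp. f_equal. rewrite (is_series_unique _ _ Ha), RInt_arcsin_quot, Im_Li3_polylog.
  replace ((1 + Ci) / 2)%C with ((1 / 2, 1 / 2) : C).
  + field. lra.
  + unfold Cdiv. rewrite <- RtoC_inv by lra. unfold Cplus, Cmult, Ci, RtoC; simpl; f_equal; field.
Qed.
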